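(* (1) Each of the four classes of rational MILP-R, binary MICP-R, MICP-R, and rational MICP-R sets is closed under (images by) rational affine transformations $\mathbb{R}^n\to\mathbb{R}^m$, finite Cartesian products, and (finite) Minkowski sums. (2) Each of the classes of rational MILP-R, binary MICP-R, and MICP-R sets is closed under finite intersection, but the class of rational MICP-R sets is not closed under finite intersection. (3) Each of the classes of binary MICP-R, MICP-R, and rational MICP-R sets is closed under finite unions, but the class of rational MILP-R sets is not closed under finite unions.
   Context: $\mathbb{N}=\{1,2,\dots\}$, $\mathbb{Z}_+=\{0,1,2,\dots\}$; $n\in\mathbb{N}$, $p,d\in\mathbb{Z}_+$. Intersections, unions and Minkowski sums are of subsets of a common $\mathbb{R}^n$. A rational affine transformation is a map $x\mapsto Ax+b$ with $A,b$ having rational entries. A closed convex set $M\subseteq\mathbb{R}^{n+p+d}$ (with $d$) induces an MICP formulation of $S\subseteq\mathbb{R}^n$ if for every $x\in\mathbb{R}^n$: $x\in S$ iff there exist $y\in\mathbb{R}^p$, $z\in\mathbb{Z}^d$ with $(x,y,z)\in M$. $S$ is MICP-R if it has an MICP formulation induced by some closed convex $M$ (for some $p,d$). $S$ is rational MILP-R if it has one with $M$ a rational polyhedron (defined by finitely many linear inequalities with rational coefficients and right-hand sides). $S$ is binary MICP-R if it has one with $M$ closed convex and $\operatorname{proj}_z(M\cap(\mathbb{R}^{n+p}\times\mathbb{Z}^d))\subseteq\{0,1\}^d$, where $\operatorname{proj}_z$ is the projection onto the last $d$ coordinates. The index set of the formulation induced by $M$ is $I=\operatorname{proj}_z(M)\subseteq\mathbb{R}^d$.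 For a convex (not necessarily closed) set $C\subseteq\mathbb{R}^d$, its recession cone is $C_\infty=\{r\in\mathbb{R}^d : x+\lambda r\in C\ \ \forall x\in C,\ \lambda\ge 0\}$. A convex set $I\subseteq\mathbb{R}^d$ is rationally unbounded if for every image $I'\subseteq\mathbb{R}^{d'}$ of $I$ under a rational affine transformation, either $I'$ is bounded or $\mathbb{Z}^{d'}\cap(I'_\infty\setminus\{0\})\neq\emptyset$. $S$ is rational MICP-R if it has an MICP formulation induced by some closed convex $M$ whose index set is rationally unbounded. *)

(* Defs.v *)
From mathcomp Require Import all_boot all_order all_algebra.
From mathcomp Require Import all_classical all_reals all_analysis.

Set Implicit Arguments.
Unset Strict Implicit.
Unset Printing Implicit Defensive.

Import Order.TTheory GRing.Theory Num.Theory.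
Import numFieldNormedType.Exports.

Local Open Scope classical_set_scope.
Local Open Scope ring_scope.

Definition rational_affine (R : realType) (n m : nat)
    (A : 'M[rat]_(m, n)) (b : 'cV[rat]_m) (x : 'cV[R]_n) : 'cV[R]_m :=
  map_mx ratr A *m x + map_mx ratr b.

Definition integer_points (R : realType) (d : nat) : set 'cV[R]_d :=
  [set z | z \is a mxOver Num.int].

Definition rational_polyhedron (R : realType) (N : nat) (M : set 'cV[R]_N) :
    Prop :=
  exists (k : nat) (A : 'M[rat]_(k, N)) (b : 'cV[rat]_k),
    M = [set v | forall i, (map_mx ratr A *m v) i 0 <= ratr (b i 0)].

Definition proj_z (R : realType) (n p d : nat) (M : set 'cV[R]_(n + p + d)) :
    set 'cV[R]_d :=
  [set dsubmx v | v in M].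

Definition MICP_formulation (R : realType) (n p d : nat)
    (M : set 'cV[R]_(n + p + d)) (S : set 'cV[R]_n) : Prop :=
  [/\ closed M, convex_set M &
    forall x : 'cV[R]_n,
      S x <-> exists (y : 'cV[R]_p) (z : 'cV[R]_d),
                integer_points z /\ M (col_mx (col_mx x y) z)].

Definition MICP_R (R : realType) (n : nat) (S : set 'cV[R]_n) : Prop :=
  exists (p d : nat) (M : set 'cV[R]_(n + p + d)), MICP_formulation M S.

Definition rational_MILP_R (R : realType) (n : nat) (S : set 'cV[R]_n) : Prop :=
  exists (p d : nat) (M : set 'cV[R]_(n + p + d)),
    MICP_formulation M S /\ rational_polyhedron M.

Definition binary_MICP_R (R : realType) (n : nat) (S : set 'cV[R]_n) : Prop :=
  exists (p d : nat) (M : set 'cV[R]_(n + p + d)),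
    MICP_formulation M S /\
    proj_z (M `&` [set v | integer_points (dsubmx v)]) `<=`
      [set z | forall i, z i 0 = 0 \/ z i 0 = 1].

Definition recession_cone (R : realType) (d : nat) (C : set 'cV[R]_d) :
    set 'cV[R]_d :=
  [set r | forall (x : 'cV[R]_d) (lambda : R),
             C x -> 0 <= lambda -> C (x + lambda *: r)].

Definition rationally_unbounded (R : realType) (d : nat) (I : set 'cV[R]_d) :
    Prop :=
  forall (d' : nat) (A : 'M[rat]_(d', d)) (b : 'cV[rat]_d'),
    let I' := [set rational_affine A b x | x in I] in
    bounded_set I' \/
    (@integer_points R d' `&` (recession_cone I' `\ 0)) !=set0.

Definition rational_MICP_R (R : realType) (n : nat) (S : set 'cV[R]_n) : Prop :=
  exists (p d : nat) (M : set 'cV[R]_(n + p + d)),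
    MICP_formulation M S /\ rationally_unbounded (proj_z M).

(* A class of subsets of Euclidean spaces. Throughout the closure properties,
   the ambient dimensions are at least 1 and a finite family is nonempty. *)
Definition set_class (R : realType) := forall n : nat, set 'cV[R]_n -> Prop.

Definition closed_under_rational_affine (R : realType) (P : set_class R) : Prop :=
  forall (n m : nat) (A : 'M[rat]_(m, n)) (b : 'cV[rat]_m) (S : set 'cV[R]_n),
    (0 < n)%N -> (0 < m)%N -> P n S ->
    P m [set rational_affine A b x | x in S].

Definition closed_under_products (R : realType) (P : set_class R) : Prop :=
  forall (k : nat) (n : 'I_k -> nat) (S : forall i, set 'cV[R]_(n i)),
    (0 < k)%N -> (forall i, 0 < n i)%N -> (forall i, P (n i) (S i)) ->
    P (\sum_i n i)%N [set x | forall i, S i (submxcol x i)].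

Definition closed_under_Minkowski_sums (R : realType) (P : set_class R) : Prop :=
  forall (n k : nat) (S : 'I_k -> set 'cV[R]_n),
    (0 < n)%N -> (0 < k)%N -> (forall i, P n (S i)) ->
    P n [set x | exists s : 'I_k -> 'cV[R]_n,
                   (forall i, S i (s i)) /\ x = \sum_i s i].

Definition closed_under_intersections (R : realType) (P : set_class R) : Prop :=
  forall (n k : nat) (S : 'I_k -> set 'cV[R]_n),
    (0 < n)%N -> (0 < k)%N -> (forall i, P n (S i)) ->
    P n (\bigcap_i S i).

Definition closed_under_unions (R : realType) (P : set_class R) : Prop :=
  forall (n k : nat) (S : 'I_k -> set 'cV[R]_n),
    (0 < n)%N -> (0 < k)%N -> (forall i, P n (S i)) ->
    P n (\bigcup_i S i).

(* Main.v *)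
Require Import Defs.
From mathcomp Require Import all_boot all_order all_algebra.
From mathcomp Require Import all_classical all_reals all_analysis.
From mathcomp Require Import ring lra zify.

(** Why the closure properties hold.  All of them come from two operations on
    the inducing convex sets.  The product of the sets M_i, read off blockwise,
    induces the product of the S_i.  Coupling starts from a set T with an
    inducing set M and from a closed convex set Q, and induces the set of all x
    for which some w in T, some real t and some integer l satisfy Q(x, w, t, l)
    ([coupled_formulationP]).  Coupling with the graph of a rational affine map
    gives images; coupling a product with the diagonal gives intersections; a
    Minkowski sum is the image of a product under addition.  Closed convex
    sets, rational polyhedra and binary integer variables survive both
    operations.

    Unions use a set Q that acts as a switch with weights l in the simplex: the
    i-th component w_i of a point of the product must satisfy
    (x_j - w_ij)^2 <= t (1 - l_i) for every coordinate j.  An integer weight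
    vector is a vertex of the simplex; at the vertex i the constraint says
    x = w_i, while the other components are unconstrained because t is free
    ([coupled_switch]).

    Rational unboundedness concerns only the index set.  It is inherited by
    rational affine images and by finite Minkowski sums ([ru_sum]), hence by
    products; the index set of a union is the product of the given index sets
    and of a simplex, which is bounded.  Coupling with the diagonal, by
    contrast, replaces the index set by a smaller one, and the property is lost.

    Why rational MICP-R sets are not closed under intersection.  The lattice
    Z^2 and the strip |sqrt 2 x_0 - x_1| <= 1 are rational MICP-R, but their
    intersection T is not.  It is infinite, contains no segment and no infinite
    arithmetic progression.  If T had such a formulation, every integer index z
    would carry at most one point x(z) of T.  A bounded index set has finitely
    many integer points, so T would be finite.  Otherwise there is an integer
    recession direction e, and along p, p + e, p + 2e, ... the points x(.) form
    an arithmetic progression by convexity, so they are all equal.  Convexity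
    then forces the same point over every index of that line, integer or not,
    so one may project along e and induct on the number of integer variables
    ([ray_fibre], [finite_of_rationally_unbounded]).

    Why rational MILP-R sets are not closed under union.  Consider Z together
    with the point 1/2.  Eliminating the continuous variables of a rational
    polyhedral formulation leaves finitely many rational inequalities
    F (x, z) <= c ([MILP_projection]).  The values of F at integer points lie in
    a lattice and are bounded above, so Dickson's lemma yields two integers
    j1 < j2, with integer indices, such that the step between the two points
    does not increase F.  Adding this step to the point over 1/2 shows that
    1/2 + (j2 - j1) is in the set, which is absurd
    ([lattice_half_not_MILP]). *)

Set Implicit Arguments.
Unset Strict Implicit.
Unset Printing Implicit Defensive.

Import Order.TTheory GRing.Theory Num.Theory.
Import numFieldNormedType.Exports.

Local Open Scope classical_set_scope.
Local Open Scope ring_scope.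

(** * Rational affine maps, convex sets and rational polyhedra *)

Section AffineMaps.
Variable R : realType.

(** A predicate rather than a pair (A, c), so that block projections and block
    assemblies are recognised as rational affine by composition, without their
    matrices ever being written down. *)
Definition is_rational_affine (a b : nat) (f : 'cV[R]_a -> 'cV[R]_b) : Prop :=
  exists (A : 'M[rat]_(b, a)) (c : 'cV[rat]_b), f =1 rational_affine A c.

Lemma ra_id a : is_rational_affine (@id 'cV[R]_a).
Proof.
by exists 1%:M, 0 => v; rewrite /rational_affine map_mx1 mul1mx map_mx0 addr0.
Qed.

Lemma ra_comp a b c (g : 'cV[R]_b -> 'cV[R]_c) (f : 'cV[R]_a -> 'cV[R]_b) :
  is_rational_affine g -> is_rational_affine f -> is_rational_affine (g \o f).
Proof.
move=> [A [u Hg]] [B [w Hf]]; exists (A *m B), (A *m w + u) => v /=.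
by rewrite Hg Hf /rational_affine mulmxDr mulmxA !map_mxM map_mxD map_mxM addrA.
Qed.

Lemma ra_affine a b (A : 'M[rat]_(b, a)) (c : 'cV[rat]_b) :
  is_rational_affine (@rational_affine R a b A c).
Proof. by exists A, c. Qed.

Lemma ra_cst a b (c : 'cV[rat]_b) :
  is_rational_affine (fun _ : 'cV[R]_a => map_mx ratr c).
Proof.
by exists 0, c => v; rewrite /rational_affine map_mx0 mul0mx add0r.
Qed.

Lemma ra_add a b (f g : 'cV[R]_a -> 'cV[R]_b) :
  is_rational_affine f -> is_rational_affine g ->
  is_rational_affine (fun v => f v + g v).
Proof.
move=> [A [u Hg]] [B [w Hf]]; exists (A + B), (u + w) => v /=.
by rewrite Hg Hf /rational_affine !map_mxD mulmxDl addrACA.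
Qed.

Lemma ra_opp a b (f : 'cV[R]_a -> 'cV[R]_b) :
  is_rational_affine f -> is_rational_affine (fun v => - f v).
Proof.
move=> [A [u Hg]]; exists (- A), (- u) => v /=.
by rewrite Hg /rational_affine !map_mxN mulNmx opprD.
Qed.

Lemma ra_usub a b1 b2 (f : 'cV[R]_a -> 'cV[R]_(b1 + b2)) :
  is_rational_affine f -> is_rational_affine (fun v => usubmx (f v)).
Proof.
move=> [A [u Hf]]; exists (usubmx A), (usubmx u) => v /=.
by rewrite Hf /rational_affine linearD /= -mul_usub_mx !map_usubmx.
Qed.

Lemma ra_dsub a b1 b2 (f : 'cV[R]_a -> 'cV[R]_(b1 + b2)) :
  is_rational_affine f -> is_rational_affine (fun v => dsubmx (f v)).
Proof.
move=> [A [u Hf]]; exists (dsubmx A), (dsubmx u) => v /=.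
by rewrite Hf /rational_affine linearD /= -mul_dsub_mx !map_dsubmx.
Qed.

Lemma ra_col a b1 b2 (f : 'cV[R]_a -> 'cV[R]_b1) (g : 'cV[R]_a -> 'cV[R]_b2) :
  is_rational_affine f -> is_rational_affine g ->
  is_rational_affine (fun v => col_mx (f v) (g v)).
Proof.
move=> [A [u Hf]] [B [w Hg]]; exists (col_mx A B), (col_mx u w) => v /=.
by rewrite Hf Hg /rational_affine !map_col_mx mul_col_mx add_col_mx.
Qed.

Lemma ra_submxcol a k (q : 'I_k -> nat) (f : 'cV[R]_a -> 'cV[R]_(\sum_i q i)) i
  :
  is_rational_affine f -> is_rational_affine (fun v => submxcol (f v) i).
Proof.
move=> [A [u Hf]]; exists (submxcol A i), (submxcol u i) => v /=.
rewrite Hf /rational_affine submxcolD -submxcol_mul.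
by congr (_ *m _ + _); apply/matrixP => x y; rewrite !mxE.
Qed.

(** The abstract domain T keeps the neighbourhood filter folded; on a space of
    matrices it would unfold, and the limit lemmas would no longer apply. *)
Lemma continuous_affine_form (T : topologicalType) (I : finType)
  (h : I -> T -> R)
    (c : I -> R) (d : R) : (forall i, continuous (h i)) ->
  continuous (fun x => \sum_i c i * h i x + d).
Proof.
move=> hc x; apply: cvgD; last exact: cvg_cst.
elim: (index_enum I) => [|i s IH].
  by under eq_fun do rewrite big_nil; rewrite big_nil; exact: cvg_cst.
under eq_fun do rewrite big_cons; rewrite big_cons; apply: cvgD => //.
by apply: cvgM; [exact: cvg_cst|exact: hc].
Qed.

Lemma ra_continuous a b (f : 'cV[R]_a -> 'cV[R]_b) :
  is_rational_affine f -> continuous f.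
Proof.
move=> [A [u Hf]]; have -> : f = rational_affine A u by apply/funext.
have Hc i : continuous (fun v : 'cV[R]_a => rational_affine A u v i 0).
  under eq_fun do rewrite !mxE.
  apply: (@continuous_affine_form 'cV[R]_a 'I_a (fun j w => w j 0)
    (fun j => (map_mx ratr A) i j)) => j.
  exact: coord_continuous.
move=> v; have FF : Filter (nbhs (v : 'cV[R]_a)) by exact: nbhs_filter.
apply/cvg_ballP => e e0.
have H i : nbhs v [set w | ball (rational_affine A u v i 0) e
                             (rational_affine A u w i 0)].
  by move/cvg_ballP : (Hc i v) => /(_ e e0).
have := @filter_forall _ _ _ (nbhs v) FF H.
by apply: (@filterS _ _ FF) => w Hw; split => // i j; rewrite (ord1 j);
  apply: Hw.
Qed.

(** The only consequence of affinity that convexity arguments use; the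
    translation part disappears because the weights sum to 1. *)
Lemma ra_conv a b (f : 'cV[R]_a -> 'cV[R]_b) : is_rational_affine f ->
  forall (t : R) v w, f (t *: v + (1 - t) *: w) = t *: f v + (1 - t) *: f w.
Proof.
move=> [A [u Hf]] t v w; rewrite !Hf /rational_affine.
rewrite mulmxDr -!scalemxAr !scalerDr addrACA -scalerDl.
by rewrite [t + _]addrC subrK scale1r.
Qed.

Lemma convex_setP (a : nat) (M : set 'cV[R]_a) :
  convex_set M <-> forall (t : R) v w, 0 <= t <= 1 -> M v -> M w ->
    M (t *: v + (1 - t) *: w).
Proof.
split=> [cM t v w /andP[t0 t1] Mv Mw|cM v w l].
  by have := cM v w (Itv01 t0 t1); rewrite !inE; apply.
by rewrite !inE => Mv Mw; apply: cM => //; apply/andP; split.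
Qed.

Lemma closed_preimage_ra a b (f : 'cV[R]_a -> 'cV[R]_b) (M : set 'cV[R]_b) :
  is_rational_affine f -> closed M -> closed (f @^-1` M).
Proof. by move=> /ra_continuous cf; apply: preimage_closed => v _;
  apply: cf. Qed.

Lemma convex_preimage_ra a b (f : 'cV[R]_a -> 'cV[R]_b) (M : set 'cV[R]_b) :
  is_rational_affine f -> convex_set M -> convex_set (f @^-1` M).
Proof.
move=> /ra_conv cf /convex_setP cM; apply/convex_setP => t v w t01 Mv Mw /=.
by rewrite cf; apply: cM.
Qed.

Lemma convex_setI a (M N : set 'cV[R]_a) :
  convex_set M -> convex_set N -> convex_set (M `&` N).
Proof.
move=> /convex_setP cM /convex_setP cN; apply/convex_setP => t v w t01.
by move=> [? ?] [? ?]; split; [apply: cM|apply: cN].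
Qed.

Lemma convex_bigcap a (I : Type) (M : I -> set 'cV[R]_a) :
  (forall i, convex_set (M i)) -> convex_set (\bigcap_i M i).
Proof.
move=> cM; apply/convex_setP => t v w t01 Mv Mw i _.
by move/convex_setP : (cM i); apply => //; [apply: Mv|apply: Mw].
Qed.

Lemma polyhedron_le0 a b (f : 'cV[R]_a -> 'cV[R]_b) :
  is_rational_affine f ->
  rational_polyhedron [set v | forall i, f v i 0 <= 0].
Proof.
move=> [A [u Hf]]; exists b, A, (- u); apply/seteqP.
have le_opp (x y : R) : (x <= - y) = (x + y <= 0) by rewrite -subr_le0 opprK.
by split=> v /= H i; have := H i; rewrite Hf !mxE rmorphN le_opp.
Qed.

Lemma polyhedron_eq a b (f g : 'cV[R]_a -> 'cV[R]_b) :
  is_rational_affine f -> is_rational_affine g ->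
  rational_polyhedron [set v | f v = g v].
Proof.
move=> Hf Hg.
have -> : [set v | f v = g v] =
  [set v | forall i, col_mx (f v - g v) (g v - f v) i 0 <= 0].
  apply/seteqP; split=> v /= H.
    by move=> i; rewrite H subrr col_mx0 mxE.
  apply/colP => i; apply/eqP; rewrite eq_le.
  have := H (lshift _ i); have := H (rshift _ i).
  by rewrite col_mxEu col_mxEd !mxE !subr_le0 => -> ->.
by apply: polyhedron_le0; apply: ra_col; apply: ra_add => //; apply: ra_opp.
Qed.

Lemma polyhedron_preimage a b (f : 'cV[R]_a -> 'cV[R]_b) (M : set 'cV[R]_b) :
  is_rational_affine f -> rational_polyhedron M ->
  rational_polyhedron (f @^-1` M).
Proof.
move=> Hf [k [A [u ->]]].
have -> : f @^-1` [set v | forall i, (map_mx ratr A *m v) i 0 <= ratr (u i 0)]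
  = [set v | forall i, rational_affine A (- u) (f v) i 0 <= 0].
  apply/seteqP; split=> v /= H i; have := H i;
  by rewrite !mxE rmorphN subr_le0.
by apply: polyhedron_le0; apply: ra_comp Hf; apply: ra_affine.
Qed.

Lemma polyhedron_setI a (M N : set 'cV[R]_a) :
  rational_polyhedron M -> rational_polyhedron N ->
  rational_polyhedron (M `&` N).
Proof.
move=> [k [A [u ->]]] [l [B [w ->]]];
  exists (k + l)%N, (col_mx A B), (col_mx u w).
apply/seteqP; split=> v /=; rewrite map_col_mx mul_col_mx.
  by move=> [H1 H2] i; case: (split_ordP i) => j ->;
    rewrite ?col_mxEu ?col_mxEd.
move=> H; split=> i.
  by have := H (lshift _ i); rewrite !col_mxEu.
by have := H (rshift _ i); rewrite !col_mxEd.
Qed.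

Lemma polyhedron_setT a : rational_polyhedron [set: 'cV[R]_a].
Proof. by exists 0%N, 0, 0; apply/seteqP; split=> v // _ []. Qed.

Lemma polyhedron_bigcap a k (M : 'I_k -> set 'cV[R]_a) :
  (forall i, rational_polyhedron (M i)) -> rational_polyhedron (\bigcap_i M i).
Proof.
move=> H; have -> : \bigcap_i M i = \big[setI/setT]_(i < k) M i.
  rewrite -bigcap_seq; congr bigcap.
  by apply/seteqP; split=> i //= _; rewrite mem_index_enum.
elim: (index_enum _) => [|i s IH]; first by rewrite big_nil;
  apply: polyhedron_setT.
by rewrite big_cons; apply: polyhedron_setI.
Qed.

Lemma polyhedron_closed a (M : set 'cV[R]_a) : rational_polyhedron M -> closed
  M.
Proof.
move=> [k [A [u ->]]].
have -> : [set v : 'cV[R]_a| forall i, (map_mx ratr A *m v) i 0 <= ratr (u i 0)]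
  = \bigcap_i ((rational_affine A 0) @^-1`
      ((fun w : 'cV[R]_k => w i 0) @^-1` [set r | r <= ratr (u i 0)])).
  apply/seteqP; split=> v /= H i; last by have := H i I;
    rewrite /= !mxE rmorph0 addr0.
  by move=> _; have := H i; rewrite /= !mxE rmorph0 addr0.
apply: closed_bigI => i _; apply: closed_preimage_ra; first exact: ra_affine.
by apply: preimage_closed;
  [move=> v _; exact: coord_continuous|exact: closed_le].
Qed.

Lemma polyhedron_convex a (M : set 'cV[R]_a) :
  rational_polyhedron M -> convex_set M.
Proof.
move=> [k [A [u ->]]]; apply/convex_setP => t v w /andP[t0 t1] /= Hv Hw i.
rewrite mulmxDr -!scalemxAr !mxE.
have := Hv i; have := Hw i; rewrite !mxE => h1 h2.
have t1' : 0 <= 1 - t by rewrite subr_ge0.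
have := lerD (ler_wpM2l t0 h2) (ler_wpM2l t1' h1).
by congr (_ <= _); ring.
Qed.

End AffineMaps.

(** * Rationally unbounded sets *)

Section RationallyUnbounded.
Variable R : realType.

Lemma bounded_cVP (d : nat) (I : set 'cV[R]_d) :
  bounded_set I <-> exists B : R, forall x, I x -> forall i, `|x i 0| <= B.
Proof.
split=> [[B [_ HB]]|[B HB]].
  exists (B + 1) => x Ix i; apply: le_trans (HB (B + 1) _ x Ix);
    last by rewrite ltrDl.
  rewrite /Num.norm/= mx_normrE.
  exact: (le_bigmax _ (fun ij : 'I_d * 'I_1 => `|x ij.1 ij.2|) (i, 0)).
exists (Num.max 0 B); split=> [|C BC x Ix /=]; first exact: num_real.
rewrite /Num.norm/= mx_normrE; apply/bigmax_leP; split=> [|[i j] _ /=].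
  by apply: le_trans (ltW BC); rewrite le_max lexx.
rewrite (ord1 j); apply: le_trans (HB x Ix i) (le_trans _ (ltW BC)).
by rewrite le_max lexx orbT.
Qed.

Lemma bounded_ra_image a b (f : 'cV[R]_a -> 'cV[R]_b) (I : set 'cV[R]_a) :
  is_rational_affine f -> bounded_set I -> bounded_set (f @` I).
Proof.
move=> [A [u Hf]] /bounded_cVP[B HB]; apply/bounded_cVP.
pose C i : R := \sum_j `|ratr (A i j)| * B + `|ratr (u i 0)|.
exists (\sum_i `|C i|) => _ [x Ix <-] i.
rewrite (bigD1 i) //= ler_wpDr ?sumr_ge0 //.
rewrite Hf !mxE; apply: le_trans (ler_normD _ _) _.
apply: le_trans (ler_norm _); apply: lerD => //.
apply: le_trans (ler_norm_sum _ _ _) _; apply: ler_sum => j _.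
by rewrite !mxE normrM ler_wpM2l // HB.
Qed.

Lemma bounded_ru d (I : set 'cV[R]_d) : bounded_set I -> rationally_unbounded I.
Proof. by move=> bI d' A b; left; apply: bounded_ra_image bI;
  apply: ra_affine. Qed.

Lemma ru_image a b (f : 'cV[R]_a -> 'cV[R]_b) (I : set 'cV[R]_a) :
  is_rational_affine f -> rationally_unbounded I ->
  rationally_unbounded (f @` I).
Proof.
move=> Hf uI d' A u.
have [B [w E]] := ra_comp (ra_affine R A u) Hf.
have := uI d' B w; rewrite /=.
suff -> : rational_affine B w @` I = rational_affine A u @` (f @` I) by [].
by rewrite image_comp; apply: eq_imagel => x _; rewrite -E.
Qed.

(** A rational affine image of a Minkowski sum is the sum of the images of the
    summands. If all of these are bounded, so is the sum; if one of them has an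
    integer recession direction, moving that summand alone shows that the
    direction recedes in the whole sum. *)
Lemma ru_sum d (J : finType) (K : J -> set 'cV[R]_d) :
  (forall j, rationally_unbounded (K j)) ->
  rationally_unbounded
    [set \sum_j f j | f in [set f : J -> 'cV[R]_d | forall j, K j (f j)]].
Proof.
move=> uK d' A b /=.
have AE (f : J -> 'cV[R]_d) : rational_affine A b (\sum_j f j) =
    \sum_j rational_affine A 0 (f j) + map_mx ratr b.
  rewrite /rational_affine mulmx_sumr; congr (_ + _).
  by apply: eq_bigr => j _; rewrite map_mx0 addr0.
have [bK|] := pselect (forall j, bounded_set (rational_affine A 0 @` K j)).
  left; apply/bounded_cVP.
  have [B HB] := choice (fun j => (bounded_cVP _).1 (bK j)).
  exists (\sum_j B j + \sum_i `|ratr (b i 0)|) => _ [_ [f Kf <-] <-] i.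
  rewrite AE mxE; apply: le_trans (ler_normD _ _) (lerD _ _).
    rewrite summxE; apply: le_trans (ler_norm_sum _ _ _) (ler_sum _ _) => j _.
    by apply: HB; exists (f j).
  by rewrite (bigD1 i) //= !mxE ler_wpDr ?sumr_ge0.
move=> /existsNP[j unb]; right.
have [//|[r [Zr [recr nz]]]] := uK j d' A 0.
exists r; split=> //; split=> // _ l [_ [f Kf <-] <-] l0.
have /= [|y Ky Ey] := recr (rational_affine A 0 (f j)) l _ l0;
  first by exists (f j).
exists (\sum_i if i == j then y else f i).
  by exists (fun i => if i == j then y else f i) => // i /=; case: eqP => [->|].
rewrite !AE (bigD1 j) //= eqxx Ey [in RHS](bigD1 j) //=.
rewrite (eq_bigr (fun i => rational_affine A 0 (f i))) => [|i /negbTE -> //].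
by rewrite (addrAC _ (l *: r)) (addrAC _ (l *: r)).
Qed.

Lemma common_denominator m n (A : 'M[rat]_(m, n)) :
  exists N : nat, (0 < N)%N /\ (N%:R *: A) \is a mxOver Num.int.
Proof.
exists (\prod_(ij : 'I_m * 'I_n) `|denq (A ij.1 ij.2)|)%N; split.
  by apply/prodn_gt0 => ij; rewrite absz_gt0 denq_neq0.
apply/mxOverP => i j;
  rewrite !mxE (bigD1 (i, j)) //= natrM mulrAC rpredM ?rpred_nat //.
have -> : `|denq (A i j)|%:R = (denq (A i j))%:~R :> rat.
  by rewrite -[in RHS]absz_denq.
by rewrite mulrC -numqE intr_int.
Qed.

Lemma ratr_int_num (q : rat) : q \is a Num.int -> (ratr q : R) \is a Num.int.
Proof. by move=> /intrP[m ->]; rewrite ratr_int intr_int. Qed.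

(** A nonzero column of the matrix, cleared of denominators, is an integer
    direction along which the image of the whole space is invariant. *)
Lemma ru_setT d : rationally_unbounded [set: 'cV[R]_d].
Proof.
move=> d' A b /=.
have [->|/matrix0Pn[i [j nz]]] := eqVneq A 0.
  left; apply/bounded_cVP; exists (\sum_i `|ratr (b i 0)|) => _ [x _ <-] i.
  rewrite /rational_affine map_mx0 mul0mx add0r mxE.
  by rewrite (bigD1 i) //= ler_wpDr ?sumr_ge0.
right; have [N [N0 ZN]] := common_denominator A.
exists (N%:R *: col j (map_mx ratr A)); split; last split.
- apply/mxOverP => k l; rewrite !mxE.
  by have /mxOverP/(_ k j) := ZN; rewrite mxE => /ratr_int_num;
    rewrite rmorphM/= ratr_nat.
- move=> _ l [x _ <-] l0; exists (x + (l * N%:R) *: delta_mx j 0) => //.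
  rewrite /rational_affine mulmxDr -scalemxAr -colE scalerA.
  by rewrite addrAC.
move=> /matrixP/(_ i 0) /eqP; rewrite !mxE mulf_eq0 pnatr_eq0 eqn0Ngt N0 /=.
by rewrite fmorph_eq0 (negbTE nz).
Qed.

End RationallyUnbounded.

(** * Products and coupling of formulations *)

Section Constructions.
Variable R : realType.

(** Turns one existential per index into families, so that the data of k
    formulations can be assembled into blocks. *)
Lemma choose_formulations k (n : 'I_k -> nat)
    (F : forall i p d, set 'cV[R]_(n i + p + d) -> Prop) :
  (forall i, exists p d (M : set 'cV[R]_(n i + p + d)), F i p d M) ->
  exists (p d : 'I_k -> nat) (M : forall i, set 'cV[R]_(n i + p i + d i)),
    forall i, F i (p i) (d i) (M i).
Proof.
move=> /choice[p /choice[d H]]; exists p, d, (fun i => sval (cid (H i))) => i.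
exact: svalP (cid (H i)).
Qed.

Section Product.
Variables (k : nat) (n p d : 'I_k -> nat).
Variable M : forall i, set 'cV[R]_(n i + p i + d i).
Arguments M : clear implicits.

Definition factor_part (i : 'I_k)
    (v : 'cV[R]_(\sum_i n i + \sum_i p i + \sum_i d i)) :
    'cV[R]_(n i + p i + d i) :=
  col_mx (col_mx (submxcol (usubmx (usubmx v)) i)
    (submxcol (dsubmx (usubmx v)) i))
         (submxcol (dsubmx v) i).

Arguments factor_part : clear implicits.

Definition product_formulation :
    set 'cV[R]_(\sum_i n i + \sum_i p i + \sum_i d i) :=
  \bigcap_i (factor_part i @^-1` M i).

Lemma factor_part_ra i : is_rational_affine (factor_part i).
Proof.
apply: ra_col; first apply: ra_col; apply: ra_submxcol.
- by apply/ra_usub/ra_usub/ra_id.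
- by apply/ra_dsub/ra_usub/ra_id.
- by apply/ra_dsub/ra_id.
Qed.

Lemma factor_part_col i x y z :
  factor_part i (col_mx (col_mx x y) z) =
  col_mx (col_mx (submxcol x i) (submxcol y i)) (submxcol z i).
Proof. by rewrite /factor_part !(col_mxKu, col_mxKd). Qed.

Lemma product_formulationP (S : forall i, set 'cV[R]_(n i)) :
  (forall i, MICP_formulation (M i) (S i)) ->
  MICP_formulation product_formulation [set x | forall i, S i (submxcol x i)].
Proof.
move=> HM; split.
- apply: closed_bigI => i _; apply: closed_preimage_ra (factor_part_ra i) _.
  by case: (HM i).
- apply: convex_bigcap => i; apply: convex_preimage_ra (factor_part_ra i) _.
  by case: (HM i).
move=> x; split=> [Sx|[y [z [Zz Mz]]] i]; last first.
  have [_ _ ->] := HM i; exists (submxcol y i), (submxcol z i); split.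
    by apply/mxOverP => a b; rewrite mxE; apply: (mxOverP Zz).
  by have := Mz i I; rewrite /= factor_part_col.
have H i : exists yz : 'cV[R]_(p i) * 'cV[R]_(d i), integer_points yz.2 /\
    M i (col_mx (col_mx (submxcol x i) yz.1) yz.2).
  have [_ _ /(_ (submxcol x i))[/(_ (Sx i))[y [z Hyz]] _]] := HM i.
  by exists (y, z).
pose y i := (sval (cid (H i))).1; pose z i := (sval (cid (H i))).2.
have Hyz i : integer_points (z i) /\ M i
  (col_mx (col_mx (submxcol x i) (y i)) (z i)).
  exact: svalP (cid (H i)).
exists (\mxcol_i y i), (\mxcol_i z i); split.
  by apply/mxOverP => a b; rewrite mxE; apply: (mxOverP (Hyz _).1).
by move=> i _; rewrite /= factor_part_col !mxcolK; exact: (Hyz i).2.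
Qed.

Lemma proj_z_product :
  proj_z product_formulation = [set z | forall i, proj_z (M i) (submxcol z i)].
Proof.
apply/seteqP; split=> [_ [v Mv <-] i|z /= /(_ _)/cid2 Hz].
  exists (factor_part i v); first exact: Mv.
  by rewrite /factor_part col_mxKd.
exists (col_mx (col_mx (\mxcol_i usubmx (usubmx (s2val (Hz i))))
                       (\mxcol_i dsubmx (usubmx (s2val (Hz i))))) z).
  move=> i _; rewrite /= factor_part_col !mxcolK.
  by case: (Hz i) => v /= Mv <-; rewrite !vsubmxK.
by rewrite col_mxKd.
Qed.

End Product.

(** The product is the Minkowski sum of its factors, each placed in its own
    block of coordinates. *)
Lemma ru_product k (d : 'I_k -> nat) (K : forall i, set 'cV[R]_(d i)) :
  (forall i, rationally_unbounded (K i)) ->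
  rationally_unbounded [set z | forall i, K i (submxcol z i)].
Proof.
move=> uK; pose E i : 'M[R]_(_, d i) := submxrow 1%:M i.
have raE i : is_rational_affine (fun w => E i *m w).
  exists (submxrow 1%:M i), 0 => w; rewrite /rational_affine map_mx0 addr0.
  by congr (_ *m _); apply/matrixP => a b; rewrite !mxE ratr_nat.
have sumE (w : forall i, 'cV[R]_(d i)) : \sum_i E i *m w i = \mxcol_i w i.
  by rewrite -mul_mxrow_mxcol submxrowK mul1mx.
have := ru_sum (fun i => ru_image (raE i) (uK i)).
congr rationally_unbounded; apply/seteqP; split=> [_ [f Kf <-] i /=|z Kz].
  have H j : exists2 w, K j w & E j *m w = f j by exact: Kf j.
  rewrite (eq_bigr (fun j => E j *m s2val (cid2 (H j)))).
    by rewrite sumE mxcolK; exact: s2valP.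
  by move=> j _; rewrite (s2valP' (cid2 (H j))).
exists (fun i => E i *m submxcol z i); last by rewrite sumE submxcolK.
by move=> i; exists (submxcol z i).
Qed.

Lemma ru_setX d k (K : set 'cV[R]_d) (L : set 'cV[R]_k) :
  rationally_unbounded K -> rationally_unbounded L ->
  rationally_unbounded [set z | K (usubmx z) /\ L (dsubmx z)].
Proof.
move=> uK uL.
have ra1 : is_rational_affine (fun w : 'cV[R]_d => col_mx w (0 : 'cV[R]_k)).
  apply: ra_col; first exact: ra_id.
  by rewrite -(map_mx0 (@ratr R)); apply: ra_cst.
have ra2 : is_rational_affine (fun w : 'cV[R]_k => col_mx (0 : 'cV[R]_d) w).
  apply: ra_col; last exact: ra_id.
  by rewrite -(map_mx0 (@ratr R)); apply: ra_cst.
have := @ru_sum R _ bool (fun b => if b then (fun w => col_mx w 0) @` K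
                                   else (fun w => col_mx 0 w) @` L).
have H b : rationally_unbounded (if b then (fun w => col_mx w 0) @` K
                                   else (fun w => col_mx 0 w) @` L).
  by case: b; exact: ru_image.
move=> /(_ H); congr rationally_unbounded; apply/seteqP; split.
  move=> _ [f Kf <-]; rewrite big_bool /=.
  have [a Ka <-] := Kf true; have [b Lb <-] := Kf false.
  by rewrite add_col_mx addr0 add0r col_mxKu col_mxKd.
move=> z [Kz Lz]; exists (fun b => if b then col_mx (usubmx z) 0
                                   else col_mx 0 (dsubmx z)).
  by case; [exists (usubmx z)|exists (dsubmx z)].
by rewrite big_bool /= add_col_mx addr0 add0r vsubmxK.
Qed.

Section Coupling.
Variables (n N q k : nat) (Q : set 'cV[R]_(n + (N + q) + k)).

(** The first block of Q holds x, the second one w and the continuous auxiliary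
    variables t, the third one the new integer variables l; thus Q has the
    shape of an inducing set, and coupling composes formulations. *)
Definition coupled_set (T : set 'cV[R]_N) : set 'cV[R]_n :=
  [set x | exists w t l,
    [/\ T w, integer_points l & Q (col_mx (col_mx x (col_mx w t)) l)]].

Section CoupledFormulation.
Variables (p d : nat) (M : set 'cV[R]_(N + p + d)).

Definition inner_part (v : 'cV[R]_(n + ((N + q) + p) + (d + k))) :
    'cV[R]_(N + p + d) :=
  col_mx (col_mx (usubmx (usubmx (dsubmx (usubmx v))))
    (dsubmx (dsubmx (usubmx v))))
         (usubmx (dsubmx v)).

Definition coupling_part (v : 'cV[R]_(n + ((N + q) + p) + (d + k))) :
    'cV[R]_(n + (N + q) + k) :=
  col_mx (col_mx (usubmx (usubmx v)) (usubmx (dsubmx (usubmx v))))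
         (dsubmx (dsubmx v)).

Definition coupled_formulation : set 'cV[R]_(n + ((N + q) + p) + (d + k)) :=
  inner_part @^-1` M `&` coupling_part @^-1` Q.

Lemma inner_part_ra : is_rational_affine inner_part.
Proof.
apply: ra_col; first apply: ra_col.
- by apply/ra_usub/ra_usub/ra_dsub/ra_usub/ra_id.
- by apply/ra_dsub/ra_dsub/ra_usub/ra_id.
- by apply/ra_usub/ra_dsub/ra_id.
Qed.

Lemma coupling_part_ra : is_rational_affine coupling_part.
Proof.
apply: ra_col; first apply: ra_col.
- by apply/ra_usub/ra_usub/ra_id.
- by apply/ra_usub/ra_dsub/ra_usub/ra_id.
- by apply/ra_dsub/ra_dsub/ra_id.
Qed.

Lemma coupled_formulation_col x w t y z l :
  coupled_formulation (col_mx (col_mx x (col_mx (col_mx w t) y)) (col_mx z l)) =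
  (M (col_mx (col_mx w y) z) /\ Q (col_mx (col_mx x (col_mx w t)) l)).
Proof.
by rewrite /coupled_formulation /setI /= /inner_part /coupling_part
  !(col_mxKu, col_mxKd).
Qed.

Lemma coupled_formulationP (T : set 'cV[R]_N) :
  closed Q -> convex_set Q -> MICP_formulation M T ->
  MICP_formulation coupled_formulation (coupled_set T).
Proof.
move=> clQ cvQ [clM cvM HM]; split.
- by apply: closedI; apply: closed_preimage_ra => //;
    [exact: inner_part_ra|exact: coupling_part_ra].
- by apply: convex_setI; apply: convex_preimage_ra => //;
    [exact: inner_part_ra|exact: coupling_part_ra].
move=> x; split=> [[w [t [l [/HM[y [z [Zz Mz]]] Zl Ql]]]]|].
  exists (col_mx (col_mx w t) y), (col_mx z l); rewrite coupled_formulation_col.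
  split=> //; apply/mxOverP => i j; case: (split_ordP i) => a ->.
    by rewrite col_mxEu; apply: (mxOverP Zz).
  by rewrite col_mxEd; apply: (mxOverP Zl).
move=> [y [z [Zz]]]; rewrite -[y]vsubmxK -[usubmx y]vsubmxK -[z]vsubmxK.
rewrite coupled_formulation_col => -[My Qy].
exists (usubmx (usubmx y)), (dsubmx (usubmx y)), (dsubmx z); split=> //.
  apply/HM; exists (dsubmx y), (usubmx z); split=> //.
  by apply/mxOverP => i j; rewrite mxE; apply: (mxOverP Zz).
by apply/mxOverP => i j; rewrite mxE; apply: (mxOverP Zz).
Qed.

(** When Q leaves w free and constrains l by L alone, the index set is a full
    product. Without this the constraint on w would cut into the index set of
    M, and rational unboundedness could fail. *)
Lemma proj_z_coupled (L : set 'cV[R]_k) :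
  (forall w l, (exists x t, Q (col_mx (col_mx x (col_mx w t)) l)) <-> L l) ->
  proj_z coupled_formulation = [set z | proj_z M (usubmx z) /\ L (dsubmx z)].
Proof.
move=> HL; apply/seteqP; split=> [_ [v [Mv Qv] <-]|z [[u Mu Eu] /=]].
  split; first by exists (inner_part v) => //; rewrite /inner_part col_mxKd.
  apply/(HL (usubmx (usubmx (dsubmx (usubmx v))))).
  exists (usubmx (usubmx v)), (dsubmx (usubmx (dsubmx (usubmx v)))).
  by rewrite vsubmxK.
move=> /(HL (usubmx (usubmx u)))[x [t Qx]].
exists (col_mx (col_mx x (col_mx (col_mx (usubmx (usubmx u)) t)
                                  (dsubmx (usubmx u)))) (col_mx (usubmx z)
                                    (dsubmx z))).
  by rewrite coupled_formulation_col -Eu !vsubmxK.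
by rewrite col_mxKd vsubmxK.
Qed.

End CoupledFormulation.

Lemma coupled_MICP (T : set 'cV[R]_N) : closed Q -> convex_set Q ->
  MICP_R T -> MICP_R (coupled_set T).
Proof.
move=> clQ cvQ [p [d [M HM]]].
by do 3!eexists; apply: coupled_formulationP HM.
Qed.

Lemma coupled_MILP (T : set 'cV[R]_N) : rational_polyhedron Q ->
  rational_MILP_R T -> rational_MILP_R (coupled_set T).
Proof.
move=> pQ [p [d [M [HM pM]]]];
  exists (N + q + p)%N, (d + k)%N, (coupled_formulation M).
split.
  by apply: coupled_formulationP => //;
    [exact: polyhedron_closed|exact: polyhedron_convex].
by apply: polyhedron_setI; apply: polyhedron_preimage => //;
    [exact: inner_part_ra|exact: coupling_part_ra].
Qed.

Lemma coupled_binary (T : set 'cV[R]_N) : closed Q -> convex_set Q ->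
  (forall x l, Q (col_mx x l) -> integer_points l ->
     forall i, l i 0 = 0 \/ l i 0 = 1) ->
  binary_MICP_R T -> binary_MICP_R (coupled_set T).
Proof.
move=> clQ cvQ bQ [p [d [M [HM bM]]]].
exists (N + q + p)%N, (d + k)%N, (coupled_formulation M).
split; first exact: coupled_formulationP.
move=> _ [v [[Mv Qv] /= Zv] <-] i; case: (split_ordP i) => j Ej; rewrite Ej.
  have /bM/(_ j) : proj_z (M `&` [set u | integer_points (dsubmx u)])
      (dsubmx (inner_part v)).
    exists (inner_part v) => //; split=> //=; rewrite /inner_part col_mxKd.
    by apply/mxOverP => a b; rewrite mxE; apply: (mxOverP Zv).
  by rewrite /inner_part col_mxKd /= [usubmx (dsubmx v) j 0]mxE.
have /= := bQ _ _ Qv _ j; rewrite [dsubmx (dsubmx v) j 0]mxE; apply.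
by apply/mxOverP => a b; rewrite mxE; apply: (mxOverP Zv).
Qed.

Lemma coupled_rational_MICP (T : set 'cV[R]_N) (L : set 'cV[R]_k) :
  closed Q -> convex_set Q -> rationally_unbounded L ->
  (forall w l, (exists x t, Q (col_mx (col_mx x (col_mx w t)) l)) <-> L l) ->
  rational_MICP_R T -> rational_MICP_R (coupled_set T).
Proof.
move=> clQ cvQ uL HL [p [d [M [HM uM]]]].
exists (N + q + p)%N, (d + k)%N, (coupled_formulation M).
split; first exact: coupled_formulationP.
by rewrite (proj_z_coupled _ HL); apply: ru_setX.
Qed.

End Coupling.

Lemma MICP_products : closed_under_products (@MICP_R R).
Proof.
move=> k n S _ _ /choose_formulations[p [d [M HM]]].
by do 3!eexists; apply: product_formulationP HM.
Qed.

Lemma MILP_products : closed_under_products (@rational_MILP_R R).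
Proof.
move=> k n S _ _ H.
have [p [d [M HM]]] := choose_formulations H.
exists (\sum_i p i)%N, (\sum_i d i)%N, (product_formulation M); split.
  by apply: product_formulationP => i; exact: (HM i).1.
apply: polyhedron_bigcap => i; apply: polyhedron_preimage (HM i).2.
exact: factor_part_ra.
Qed.

Lemma binary_products : closed_under_products (@binary_MICP_R R).
Proof.
move=> k n S _ _ H.
have [p [d [M HM]]] := choose_formulations H.
exists (\sum_i p i)%N, (\sum_i d i)%N, (product_formulation M); split.
  by apply: product_formulationP => i; exact: (HM i).1.
move=> _ [v [Mv /= Zv] <-] a; set i := tagnat.sig1 a.
have -> : dsubmx v a 0 = dsubmx (@factor_part k n p d i v) (tagnat.sig2 a) 0.
  by rewrite /factor_part col_mxKd [RHS]mxE tagnat.sig2K.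
have [_ bM] := HM i; apply: bM; exists (@factor_part k n p d i v) => //; split.
  exact: Mv.
by rewrite /= /factor_part col_mxKd;
  apply/mxOverP => b c; rewrite mxE; apply: (mxOverP Zv).
Qed.

Lemma rational_MICP_products : closed_under_products (@rational_MICP_R R).
Proof.
move=> k n S _ _ H.
have [p [d [M HM]]] := choose_formulations H.
exists (\sum_i p i)%N, (\sum_i d i)%N, (product_formulation M); split.
  by apply: product_formulationP => i; exact: (HM i).1.
rewrite proj_z_product; apply: (@ru_product _ _ (fun i => proj_z (M i))) => i.
exact: (HM i).2.
Qed.

End Constructions.

(** * Images, sums, intersections and unions *)

Section Closure.
Variable R : realType.

(** Q has neither auxiliary nor integer variables. Such a constraint is
    harmless to every class but the rational MICP-R sets, whose index set it
    may shrink. *)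
Definition closed_under_polyhedral_coupling (P : set_class R) : Prop :=
  forall n N (Q : set 'cV[R]_(n + (N + 0) + 0)) (T : set 'cV[R]_N),
    rational_polyhedron Q -> P N T -> P n (coupled_set Q T).

Lemma MILP_polyhedral_coupling :
  closed_under_polyhedral_coupling (@rational_MILP_R R).
Proof. by move=> n N Q T; exact: coupled_MILP. Qed.

Lemma MICP_polyhedral_coupling : closed_under_polyhedral_coupling (@MICP_R R).
Proof.
move=> n N Q T pQ; apply: coupled_MICP.
  exact: polyhedron_closed.
exact: polyhedron_convex.
Qed.

Lemma binary_polyhedral_coupling :
  closed_under_polyhedral_coupling (@binary_MICP_R R).
Proof.
move=> n N Q T pQ; apply: coupled_binary.
- exact: polyhedron_closed.
- exact: polyhedron_convex.
by move=> x l _ _ [].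
Qed.

Section Images.
Variables (n m : nat) (A : 'M[rat]_(m, n)) (b : 'cV[rat]_m).

Definition affine_graph : set 'cV[R]_(m + (n + 0) + 0) :=
  [set v | usubmx (usubmx v) = rational_affine A b
    (usubmx (dsubmx (usubmx v)))].

Lemma affine_graph_polyhedron : rational_polyhedron affine_graph.
Proof.
apply: polyhedron_eq; first by apply/ra_usub/ra_usub/ra_id.
apply: ra_comp; first exact: ra_affine.
by apply/ra_usub/ra_dsub/ra_usub/ra_id.
Qed.

Lemma coupled_affine_graph (S : set 'cV[R]_n) :
  coupled_set affine_graph S = [set rational_affine A b x | x in S].
Proof.
apply/seteqP; split=> [x [w [t [l [Sw _]]]]|_ [w Sw <-]].
  by rewrite /affine_graph /= !(col_mxKu, col_mxKd) => ->; exists w.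
exists w, 0, 0; split => //; first by apply/mxOverP => -[].
by rewrite /affine_graph /= !(col_mxKu, col_mxKd).
Qed.

End Images.

Lemma affine_of_coupling (P : set_class R) :
  closed_under_polyhedral_coupling P -> closed_under_rational_affine P.
Proof.
move=> cP n m A b S _ _ PS; rewrite -coupled_affine_graph; apply: cP => //.
exact: affine_graph_polyhedron.
Qed.

(** The graph of a map constrains x alone, so the index set does not change. *)
Lemma rational_MICP_affine : closed_under_rational_affine (@rational_MICP_R R).
Proof.
move=> n m A b S _ _; rewrite -coupled_affine_graph.
apply: (@coupled_rational_MICP _ _ _ _ _ _ _ setT).
- exact: (polyhedron_closed (affine_graph_polyhedron A b)).
- exact: (polyhedron_convex (affine_graph_polyhedron A b)).
- exact: ru_setT.
move=> w l; split=> // _; exists (rational_affine A b w), 0.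
by rewrite /affine_graph /= !(col_mxKu, col_mxKd).
Qed.

Lemma sum_const_gt0 n k : (0 < n)%N -> (0 < k)%N -> (0 < \sum_(i < k) n)%N.
Proof. by move=> n0 k0; rewrite sum_nat_const card_ord muln_gt0 k0. Qed.

(** The Minkowski sum is the image of the product under the rational linear map
    that adds up the blocks. *)
Lemma Minkowski_of_products (P : set_class R) :
  closed_under_products P -> closed_under_rational_affine P ->
  closed_under_Minkowski_sums P.
Proof.
move=> prodP affP n k S n0 k0 PS.
have := affP _ n (\mxrow_(i < k) 1%:M) 0 _ (sum_const_gt0 n0 k0) n0
  (prodP k (fun=> n) S k0 (fun=> n0) PS).
have sumE (x : 'cV[R]_(\sum_(i < k) n)) :
    rational_affine (\mxrow_(i < k) 1%:M) 0 x = \sum_i submxcol x i.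
  rewrite /rational_affine map_mx0 addr0 -{1}[x]submxcolK.
  have -> : map_mx ratr (\mxrow_(i < k) (1%:M : 'M[rat]_n))
          = \mxrow_(i < k) (1%:M : 'M[R]_n).
    by apply/matrixP => a b; rewrite !mxE ratr_nat.
  by rewrite mul_mxrow_mxcol; apply: eq_bigr => i _; rewrite mul1mx.
congr (P n _); apply/seteqP; split=> [_ [x Sx <-]|x [s [Ss ->]]] /=.
  by exists (fun i => submxcol x i); rewrite sumE.
exists (\mxcol_i s i); first by move=> i /=; rewrite mxcolK.
by rewrite sumE; apply: eq_bigr => i _; rewrite mxcolK.
Qed.

Definition diagonal n k : set 'cV[R]_(n + (\sum_(i < k) n + 0) + 0) :=
  \bigcap_(i : 'I_k) [set v | submxcol (p_ := fun=> n)
    (usubmx (dsubmx (usubmx v))) i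
                              = usubmx (usubmx v)].

Lemma diagonal_polyhedron n k : rational_polyhedron (@diagonal n k).
Proof.
apply: polyhedron_bigcap => i; apply: polyhedron_eq.
  by apply/ra_submxcol/ra_usub/ra_dsub/ra_usub/ra_id.
by apply/ra_usub/ra_usub/ra_id.
Qed.

(** A point of the intersection is a point of the product with equal blocks. *)
Lemma intersections_of_coupling (P : set_class R) :
  closed_under_products P -> closed_under_polyhedral_coupling P ->
  closed_under_intersections P.
Proof.
move=> prodP cP n k S n0 k0 PS.
have := cP _ _ _ _ (@diagonal_polyhedron n k)
  (prodP k (fun=> n) S k0 (fun=> n0) PS).
congr (P n _); apply/seteqP; split=> [x [w [t [l [Sw _ D]]]] i _|x Sx].
  have := D i I; rewrite /= !(col_mxKu, col_mxKd) => <-; exact: Sw.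
exists (\mxcol_i x), 0, 0; split; first by move=> i /=; rewrite mxcolK;
  exact: Sx.
  by apply/mxOverP => -[].
by move=> i _ /=; rewrite !(col_mxKu, col_mxKd) mxcolK.
Qed.

Definition simplex k : set 'cV[R]_k :=
  [set l | (forall i, 0 <= l i 0) /\ \sum_i l i 0 = 1].

Lemma simplex_polyhedron k : rational_polyhedron (@simplex k).
Proof.
have -> : @simplex k = [set l : 'cV[R]_k | forall i, (- l) i 0 <= 0] `&`
    [set l | rational_affine (const_mx 1 : 'M[rat]_(1, k)) 0 l = map_mx ratr
      (const_mx 1)].
  have E (l : 'cV[R]_k) :
      rational_affine (const_mx 1 : 'M[rat]_(1, k)) 0 l = const_mx
        (\sum_i l i 0).
    apply/matrixP => i j; rewrite (ord1 j) !mxE rmorph0 addr0.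
    by apply: eq_bigr => s _; rewrite !mxE rmorph1 mul1r.
  apply/seteqP; split=> l /= [H1 H2]; split.
  - by move=> i; rewrite mxE oppr_le0.
  - by rewrite E H2 map_const_mx rmorph1.
  - by move=> i; have := H1 i; rewrite mxE oppr_le0.
  by move: H2; rewrite E map_const_mx rmorph1 => /matrixP/(_ 0 0); rewrite !mxE.
apply: polyhedron_setI; first by apply/polyhedron_le0/ra_opp/ra_id.
by apply: polyhedron_eq; [exact: ra_affine|exact: ra_cst].
Qed.

Lemma simplex_le1 k (l : 'cV[R]_k) i : simplex l -> l i 0 <= 1.
Proof.
by move=> [l0 <-]; rewrite (bigD1 i) //= lerDl; apply: sumr_ge0.
Qed.

Lemma simplex_bounded k : bounded_set (@simplex k).
Proof.
apply/bounded_cVP; exists 1 => l sl i; rewrite ger0_norm ?simplex_le1 //.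
exact: sl.1.
Qed.

(** [tangent_eq0] and [tangent_le] compare a^2 <= t s with the half-planes 2 mu
    a <= t + mu^2 s, one for each real mu, that cut it out when s and t are
    nonnegative. This is the case s = 0. *)
Lemma tangent_eq0 (t a : R) : (forall mu, 2 * mu * a <= t) -> a = 0.
Proof.
move=> H; apply/eqP/negP => /negP a0.
have := H ((`|t| + 1) / (2 * a)).
have -> : 2 * ((`|t| + 1) / (2 * a)) * a = `|t| + 1 by field.
by have := ler_norm t; lra.
Qed.

Lemma tangent_le (t a s mu : R) : 0 < s -> a ^+ 2 / s <= t ->
  2 * mu * a <= t + mu ^+ 2 * s.
Proof.
move=> s0 ts; rewrite -subr_ge0; apply: (@le_trans _ _ ((a - mu * s) ^+ 2 / s)).
  by apply: divr_ge0; [exact: sqr_ge0|exact: ltW].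
have -> : (a - mu * s) ^+ 2 / s = a ^+ 2 / s - 2 * mu * a + mu ^+ 2 * s.
  by field; rewrite gt_eqF.
lra.
Qed.

Section Unions.
Variables (n k : nat).

(** A point stacks x, the blocks w_1, ..., w_k, the scalar t and the weights l.
    *)
Definition switch_domain := 'cV[R]_(n + (\sum_(i < k) n + 1) + k).

Definition gap (i : 'I_k) (j : 'I_n) (v : switch_domain) : R :=
  (usubmx (usubmx v) - submxcol (usubmx (dsubmx (usubmx v))) i) j 0.

Definition slack (v : switch_domain) : R := dsubmx (dsubmx (usubmx v)) 0 0.

Definition tangent (i : 'I_k) (j : 'I_n) (mu : R) : set switch_domain :=
  [set v | 2 * mu * gap i j v <= slack v + mu ^+ 2 * (1 - dsubmx v i 0)].

(** The constraint (x_j - w_ij)^2 <= t (1 - l_i), with l in the simplex, as an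
    intersection of half-spaces: being closed and convex is then immediate. *)
Definition switch : set switch_domain :=
  dsubmx @^-1` @simplex k `&` \bigcap_(s : 'I_k * 'I_n * R) tangent s.1.1 s.1.2
    s.2.

Lemma continuous_ra_coord a b (f : 'cV[R]_a -> 'cV[R]_b) i :
  is_rational_affine f -> continuous (fun v => f v i 0).
Proof.
move=> /ra_continuous cf v.
apply: (@continuous_comp _ _ _ f (fun w : 'cV[R]_b => w i 0)); first exact: cf.
exact: coord_continuous.
Qed.

Let continuous_tangent (T : topologicalType) (f g h : T -> R) (mu : R) :
  continuous f -> continuous g -> continuous h ->
  continuous (fun v => 2 * mu * f v - (g v + mu ^+ 2 * (1 - h v))).
Proof.
move=> cf cg ch v; apply: cvgB.
  by apply: cvgM; [exact: cvg_cst|exact: cf].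
apply: cvgD; first exact: cg.
apply: cvgM; first exact: cvg_cst.
by apply: cvgB; [exact: cvg_cst|exact: ch].
Qed.

Let gap_ra i : is_rational_affine (fun v : switch_domain =>
  usubmx (usubmx v) - submxcol (usubmx (dsubmx (usubmx v))) i).
Proof.
apply: ra_add; first by apply/ra_usub/ra_usub/ra_id.
by apply/ra_opp/ra_submxcol/ra_usub/ra_dsub/ra_usub/ra_id.
Qed.

Let slack_ra : is_rational_affine (fun v : switch_domain =>
  dsubmx (dsubmx (usubmx v))).
Proof. by apply/ra_dsub/ra_dsub/ra_usub/ra_id. Qed.

Let weight_ra : is_rational_affine (fun v : switch_domain => dsubmx v).
Proof. by apply/ra_dsub/ra_id. Qed.

Lemma closed_switch : closed switch.
Proof.
apply: closedI.
  exact: (closed_preimage_ra weight_ra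
    (polyhedron_closed (@simplex_polyhedron k))).
apply: closed_bigI => -[[i j] mu] _ /=.
have -> : tangent i j mu =
    (fun v => 2 * mu * gap i j v - (slack v + mu ^+ 2 * (1 - dsubmx v i 0)))
      @^-1` [set r | r <= 0].
  by apply/seteqP; split=> v; rewrite /tangent /= subr_le0.
apply: preimage_closed; last exact: closed_le.
move=> v _; apply: (@continuous_tangent switch_domain).
- by apply: continuous_ra_coord; exact: gap_ra.
- by apply: continuous_ra_coord; exact: slack_ra.
- by apply: continuous_ra_coord; exact: weight_ra.
Qed.

Lemma convex_switch : convex_set switch.
Proof.
apply: convex_setI.
  exact: (convex_preimage_ra weight_ra
    (polyhedron_convex (@simplex_polyhedron k))).
apply: convex_bigcap => -[[i j] mu] /=; apply/convex_setP => t v w /andP[t0 t1].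
rewrite /tangent /= /gap /slack (ra_conv (gap_ra i)) (ra_conv slack_ra).
rewrite (ra_conv weight_ra).
have convE c (X Y : 'cV[R]_c) e :
    (t *: X + (1 - t) *: Y) e 0 = t * X e 0 + (1 - t) * Y e 0 by rewrite !mxE.
rewrite !convE => hv hw; have t1' : 0 <= 1 - t by rewrite subr_ge0.
rewrite -subr_ge0; move: hv hw; rewrite -subr_ge0 => /(mulr_ge0 t0) hv.
rewrite -subr_ge0 => /(mulr_ge0 t1') hw; have := addr_ge0 hv hw.
by congr (_ <= _); ring.
Qed.

Lemma switchE x w t l : switch (col_mx (col_mx x (col_mx w t)) l) <->
  simplex l /\ forall i j mu,
    2 * mu * (x j 0 - submxcol (p_ := fun=> n) w i j 0)
      <= t 0 0 + mu ^+ 2 * (1 - l i 0).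
Proof.
rewrite /switch /setI /= col_mxKd; split=> -[sl H]; split=> //.
  move=> i j mu; have := H (i, j, mu) I.
  rewrite /tangent /gap /slack /= !(col_mxKu, col_mxKd).
  by rewrite [X in 2 * mu * X]mxE [X in _ + X]mxE.
move=> [[i j] mu] _; rewrite /tangent /gap /slack /= !(col_mxKu, col_mxKd).
by rewrite [X in 2 * mu * X]mxE [X in _ + X]mxE.
Qed.

(** At a weight 1 the gap is zero by hypothesis; elsewhere 1 - l_i > 0, and any
    t above all the quotients gap^2 / (1 - l_i) works. Their sum is such a t.
    *)
Lemma switch_slack (x : 'cV[R]_n) w l : simplex l ->
  (forall i, l i 0 = 1 -> x = submxcol (p_ := fun=> n) w i) ->
  exists t, switch (col_mx (col_mx x (col_mx w t)) l).
Proof.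
move=> sl Hx; pose D i j := x j 0 - submxcol (p_ := fun=> n) w i j 0.
pose c i j := D i j ^+ 2 / (1 - l i 0).
have c0 i j : 0 <= c i j.
  by rewrite divr_ge0 ?sqr_ge0 // subr_ge0 simplex_le1.
exists (const_mx (\sum_i \sum_j c i j)); apply/switchE; split=> // i j mu.
rewrite [const_mx _ _ _]mxE -/(D i j); have [l1|l1] := eqVneq (l i 0) 1.
  rewrite l1 subrr mulr0 addr0 /D (Hx i l1) subrr mulr0.
  by apply: sumr_ge0 => a _; apply: sumr_ge0.
apply: tangent_le; first by rewrite subr_gt0 lt_neqAle l1 simplex_le1.
rewrite (bigD1 i) //= (bigD1 j) //= -/(c i j) -addrA lerDl addr_ge0 //.
  by apply: sumr_ge0.
by apply: sumr_ge0 => a _; apply: sumr_ge0.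
Qed.

(** The switch constrains its integer block only through the simplex: at a
    vertex i take x = w_i, at any other point of the simplex every x will do.
    *)
Lemma switch_weights w l :
  (exists x t, switch (col_mx (col_mx x (col_mx w t)) l)) <-> simplex l.
Proof.
split=> [[x [t /switchE[]//]]|sl].
have [[i li]|nl] := pselect (exists i, l i 0 = 1).
  exists (submxcol (p_ := fun=> n) w i); apply: switch_slack => // j lj.
  have [-> //|ij] := eqVneq j i; move: sl => [l0].
  rewrite (bigD1 i) //= (bigD1 j) //= li lj => E.
  have : 0 <= \sum_(a < k | (a != i) && (a != j)) l a 0 by apply: sumr_ge0.
  by move=> E'; exfalso; lra.
exists 0; apply: switch_slack => // i li; case: nl; by exists i.
Qed.

Lemma switch_binary x l : switch (col_mx x l) -> integer_points l ->
  forall i, l i 0 = 0 \/ l i 0 = 1.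
Proof.
move=> [/=]; rewrite col_mxKd => sl _ /mxOverP Zl i.
have /intrP[m Em] := Zl i 0; have := sl.1 i; have := simplex_le1 i sl.
rewrite Em ler0z lerz1.
by case: m {Em} => [[|[|]]|] //; [left|right].
Qed.

(** Nonemptiness is essential: the components that are switched off still have
    to be points of their sets. *)
Lemma coupled_switch (S : 'I_k -> set 'cV[R]_n) :
  (forall i, S i !=set0) ->
  coupled_set switch [set w | forall i, S i (submxcol (p_ := fun=> n) w i)]
    = \bigcup_i S i.
Proof.
move=> /(_ _)/cid nS; apply/seteqP;
  split=> [x [w [t [l [Sw Zl sw]]]]|x [i _ Sx]].
  have bl := switch_binary sw Zl; have [sl tg] := (switchE _ _ _ _).1 sw.
  have [i li] : exists i, l i 0 = 1.
    apply: contrapT => /forallNP nl; have := sl.2.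
    rewrite big1 => [/esym/eqP|i _]; first by rewrite oner_eq0.
    by have [//|/nl] := bl i.
  exists i => //; suff -> : x = submxcol (p_ := fun=> n) w i by exact: Sw.
  apply/colP => j; apply/eqP; rewrite -subr_eq0; apply/eqP.
  apply: (@tangent_eq0 (t 0 0)) => mu.
  by have := tg i j mu; rewrite li subrr mulr0 addr0.
pose y j := if j == i then x else sval (nS j).
have Sy j : S j (y j).
  by rewrite /y; case: eqP => [->|_] //; exact: svalP (nS j).
pose l : 'cV[R]_k := delta_mx i 0.
have lE j : l j 0 = (j == i)%:R by rewrite mxE eqxx andbT.
have sl : simplex l.
  split=> [j|]; first by rewrite lE ler0n.
  rewrite (bigD1 i) //= lE eqxx big1 ?addr0 // => j /negbTE ji.
  by rewrite lE ji.
have [|t Ht] := @switch_slack x (\mxcol_j y j) l sl.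
  move=> j; rewrite lE mxcolK /y.
  by case: eqP => // _ /eqP; rewrite eq_sym oner_eq0.
exists (\mxcol_j y j), t, l; split=> //; first by move=> j /=; rewrite mxcolK.
by apply/mxOverP => a b; rewrite (ord1 b) lE rpred_nat.
Qed.

End Unions.

(** Empty members are replaced by a nonempty one, which does not change the
    union. *)
Lemma unions_of_switch (P : set_class R) :
  closed_under_products P ->
  (forall n k T, P _ T -> P n (coupled_set (@switch n k) T)) ->
  closed_under_unions P.
Proof.
move=> prodP swP n [//|k] S n0 _ PS.
have [[i0 [x0 Sx0]]|nS] := pselect (exists i, S i !=set0); last first.
  have S0 i : S i = set0.
    by apply/seteqP; split=> // x Sx; case: nS; exists i, x.
  by rewrite bigcup0 // -(S0 ord0).
pose S' i := if pselect (S i !=set0) then S i else S i0.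
have PS' i : P n (S' i) by rewrite /S'; case: pselect => h; exact: PS.
have nS' i : S' i !=set0 by rewrite /S'; case: pselect => // h; exists x0.
have -> : \bigcup_i S i = \bigcup_i S' i.
  apply/seteqP; split=> x [i _ Sx].
    exists i => //; rewrite /S'; case: pselect => // -[]; by exists x.
  by move: Sx; rewrite /S'; case: pselect => h Sx; [exists i|exists i0].
rewrite -coupled_switch //; apply: swP.
exact: (prodP k.+1 (fun=> n) S').
Qed.

Lemma MICP_switch n k T : MICP_R T -> MICP_R (coupled_set (@switch n k) T).
Proof. by apply: coupled_MICP; [exact: closed_switch|exact: convex_switch]. Qed.

Lemma binary_switch n k T :
  binary_MICP_R T -> binary_MICP_R (coupled_set (@switch n k) T).
Proof.
apply: coupled_binary; [exact: closed_switch|exact: convex_switch|].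
exact: switch_binary.
Qed.

Lemma rational_MICP_switch n k T :
  rational_MICP_R T -> rational_MICP_R (coupled_set (@switch n k) T).
Proof.
apply: coupled_rational_MICP (@switch_weights n k).
- exact: closed_switch.
- exact: convex_switch.
exact/bounded_ru/simplex_bounded.
Qed.

End Closure.

(** * Convex sets and lattices *)

Section BasicSets.
Variable R : realType.

Definition cylinder n (C : set 'cV[R]_n) : set 'cV[R]_(n + 0 + 0) :=
  (fun v => usubmx (usubmx v)) @^-1` C.

Lemma cylinder_formulation n (C : set 'cV[R]_n) :
  closed C -> convex_set C -> MICP_formulation (cylinder C) C.
Proof.
have ra : is_rational_affine (fun v : 'cV[R]_(n + 0 + 0) => usubmx (usubmx v)).
  by apply/ra_usub/ra_usub/ra_id.
move=> clC cvC; split.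
- exact: closed_preimage_ra ra clC.
- exact: convex_preimage_ra ra cvC.
move=> x; rewrite /cylinder /=; split=> [Cx|[y [z [_]]]];
  last by rewrite !col_mxKu.
by exists 0, 0; rewrite !col_mxKu; split=> //; apply/mxOverP => -[].
Qed.

Lemma polyhedron_MILP n (C : set 'cV[R]_n) :
  rational_polyhedron C -> rational_MILP_R C.
Proof.
move=> pC; exists 0%N, 0%N, (cylinder C); split.
  by apply: cylinder_formulation;
    [exact: polyhedron_closed|exact: polyhedron_convex].
by apply: polyhedron_preimage pC; apply/ra_usub/ra_usub/ra_id.
Qed.

Lemma convex_rational_MICP n (C : set 'cV[R]_n) :
  closed C -> convex_set C -> rational_MICP_R C.
Proof.
move=> clC cvC; exists 0%N, 0%N, (cylinder C); split.
  exact: cylinder_formulation.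
by apply/bounded_ru/bounded_cVP; exists 0 => ? _ [].
Qed.

Definition lattice_graph n : set 'cV[R]_(n + 0 + n) :=
  [set v | usubmx (usubmx v) = dsubmx v].

Lemma lattice_graph_polyhedron n : rational_polyhedron (@lattice_graph n).
Proof.
by apply: polyhedron_eq; [apply/ra_usub/ra_usub/ra_id|apply/ra_dsub/ra_id].
Qed.

Lemma lattice_formulation n :
  MICP_formulation (@lattice_graph n) (@integer_points R n).
Proof.
split.
- exact: polyhedron_closed (@lattice_graph_polyhedron n).
- exact: polyhedron_convex (@lattice_graph_polyhedron n).
move=> x; rewrite /lattice_graph /=; split=> [Zx|[y [z [Zz]]]].
  by exists 0, x; rewrite !col_mxKu col_mxKd.
by rewrite !col_mxKu col_mxKd => ->.
Qed.

Lemma lattice_MILP n : rational_MILP_R (@integer_points R n).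
Proof.
exists 0%N, n, (@lattice_graph n); split; first exact: lattice_formulation.
exact: lattice_graph_polyhedron.
Qed.

Lemma lattice_rational_MICP n : rational_MICP_R (@integer_points R n).
Proof.
exists 0%N, n, (@lattice_graph n); split; first exact: lattice_formulation.
have -> : proj_z (@lattice_graph n) = setT; last exact: ru_setT.
apply/seteqP; split=> // z _; exists (col_mx (col_mx z 0) z);
  last by rewrite col_mxKd.
by rewrite /lattice_graph /= !col_mxKu col_mxKd.
Qed.

End BasicSets.

(** * Fourier-Motzkin elimination *)

Section Elimination.
Variable R : realType.

(** One step of Fourier-Motzkin elimination. A real t has upper bounds c_i /
    g_i for g_i > 0 and lower bounds c_j / g_j for g_j < 0; it exists as soon
    as every lower bound is below every upper bound and the rows with g_i = 0
    hold. The pairs (i, j) index these conditions. *)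
Lemma eliminate_one k (g : 'cV[rat]_k) :
  exists k' (V : 'M[rat]_(k', k)), forall c : 'cV[R]_k,
    (exists t : R, forall i, ratr (g i 0) * t <= c i 0) <->
    (forall s, 0 <= (map_mx ratr V *m c) s 0).
Proof.
(* The row (i, j) combines an upper and a lower bound, or repeats the row i
   if g_i = 0, or is trivial. *)
pose row (s : 'I_k * 'I_k) (l : 'I_k) : rat :=
  if (0 < g s.1 0) && (g s.2 0 < 0) then g s.1 0 * (l == s.2)%:R - g s.2 0 *
    (l == s.1)%:R
  else if g s.1 0 == 0 then (l == s.1)%:R else 0.
pose V : 'M[rat]_(_, k) := \matrix_(s < #|{: 'I_k * 'I_k}|, l < k) row
  (enum_val s) l.
exists #|{: 'I_k * 'I_k}|, V => c.
pose G i : R := ratr (g i 0).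
have sum_delta i : \sum_l (l == i)%:R * c l 0 = c i 0.
  by rewrite (bigD1 i) //= eqxx mul1r big1 ?addr0 // => l /negbTE ->;
    rewrite mul0r.
have rowE s : \sum_l ratr (row s l) * c l 0 =
    if (0 < g s.1 0) && (g s.2 0 < 0) then G s.1 * c s.2 0 - G s.2 * c s.1 0
    else if g s.1 0 == 0 then c s.1 0 else 0.
  rewrite /row; case: ifP => _; last case: ifP => _.
  - rewrite -[in RHS](sum_delta s.2) -[in RHS](sum_delta s.1) !mulr_sumr -sumrB.
    apply: eq_bigr => l _; rewrite rmorphB !rmorphM /= !ratr_nat /G; ring.
  - by rewrite -[RHS](sum_delta s.1); apply: eq_bigr => l _; rewrite ratr_nat.
  by apply: big1 => l _; rewrite rmorph0 mul0r.
have G_gt0 i : (0 < G i) = (0 < g i 0) by rewrite ltr0q.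
have G_lt0 i : (G i < 0) = (g i 0 < 0) by rewrite ltrq0.
have -> : (forall s, 0 <= (map_mx ratr V *m c) s 0) <->
    (forall s, 0 <= \sum_l ratr (row s l) * c l 0).
  split=> H s.
    have := H (enum_rank s); rewrite mxE.
    by under eq_bigr do rewrite !mxE enum_rankK.
  by rewrite mxE; under eq_bigr do rewrite !mxE; exact: H.
split=> [[t Ht] [i j]|H].
  rewrite rowE /=; case: ifP => [/andP[gi gj]|_]; last first.
    by case: ifP => // /eqP gi; have := Ht i; rewrite gi rmorph0 mul0r.
  rewrite -G_gt0 in gi; rewrite -G_lt0 in gj.
  have := ler_wpM2l (ltW gi) (Ht j); have := ler_wnM2l (ltW gj) (Ht i).
  rewrite -/(G i) -/(G j); nra.
have H1 i : G i = 0 -> 0 <= c i 0.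
  move=> Gi; have gi : g i 0 = 0 by apply/eqP; rewrite -(fmorph_eq0 (@ratr R));
    apply/eqP.
  by have := H (i, i); rewrite rowE /= gi ltxx eqxx.
have H2 i j : 0 < G i -> G j < 0 -> G j * c i 0 <= G i * c j 0.
  by move=> Gi Gj; have := H (i, j);
    rewrite rowE /= -G_gt0 -G_lt0 Gi Gj subr_ge0.
pose q i := c i 0 / G i.
have [[j0 Gj0]|noneg] := pselect (exists j, G j < 0); last first.
  (* Without a lower bound, any sufficiently negative number works. *)
  exists (- \sum_i `|q i|) => i; rewrite -/(G i).
  have [Gi|Gi|/esym Gi] := ltgtP 0 (G i); last by rewrite Gi mul0r; exact: H1.
    rewrite mulrC -ler_pdivlMr // lerNl -/(q i).
    apply: (@le_trans _ _ `|q i|); first by rewrite -normrN ler_norm.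
    by rewrite (bigD1 i) //= lerDl sumr_ge0.
  by case: noneg; exists i.
pose j := [arg max_(j > j0 | (G j < 0)) q j]%O.
have [Gj jmax] : G j < 0 /\ forall i, G i < 0 -> q i <= q j.
  by rewrite /j; case: arg_maxP => // a Ga amax.
(* The largest lower bound is the value of t. *)
exists (q j) => i; rewrite -/(G i).
have [Gi|Gi|/esym Gi] := ltgtP 0 (G i); last by rewrite Gi mul0r; exact: H1.
  rewrite /q mulrA ler_ndivrMr //; have := H2 i j Gi Gj; lra.
by rewrite mulrC -ler_ndivrMr // jmax.
Qed.

(** A finite and rational form of Farkas' lemma: solvability in y depends on
    the right-hand side only through finitely many rational functionals. *)
Lemma eliminate p k (G : 'M[rat]_(k, p)) :
  exists k' (U : 'M[rat]_(k', k)), forall c : 'cV[R]_k,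
    (exists y : 'cV[R]_p, forall i, (map_mx ratr G *m y) i 0 <= c i 0) <->
    (forall s, 0 <= (map_mx ratr U *m c) s 0).
Proof.
elim: p G => [|p IH] G.
  exists k, 1%:M => c; rewrite map_mx1 mul1mx.
  have E (y : 'cV[R]_0) i : (map_mx ratr G *m y) i 0 = 0 by rewrite mxE
    big_ord0.
  by split=> [[y H] i|H]; [rewrite -(E y i)|exists 0 => i; rewrite E].
rewrite -[p.+1]/(1 + p)%N in G *.
have [k1 [U HU]] := IH (rsubmx G).
have [k2 [V HV]] := eliminate_one (U *m lsubmx G).
exists k2, (V *m U) => c; rewrite map_mxM -mulmxA -HV.
have split_col (y : 'cV[R]_(1 + p)) : map_mx ratr G *m y =
    map_mx ratr (lsubmx G) *m usubmx y + map_mx ratr (rsubmx G) *m dsubmx y.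
  by rewrite -[in LHS](hsubmxK G) map_row_mx -{1}[y]vsubmxK mul_row_col.
have shift (a b e : R) : (a + b <= e) = (b <= e - a) by rewrite lerBrDl.
have step (y1 : 'cV[R]_1) :
    (exists y2 : 'cV[R]_p, forall i, (map_mx ratr G *m col_mx y1 y2) i 0 <= c i
      0)
    <-> forall i, ratr ((U *m lsubmx G) i 0) * y1 0 0 <= (map_mx ratr U *m c) i
      0.
  have := HU (c - map_mx ratr (lsubmx G) *m y1).
  have -> : (exists y : 'cV[R]_p, forall i, (map_mx ratr (rsubmx G) *m y) i 0 <=
       (c - map_mx ratr (lsubmx G) *m y1) i 0) <->
    (exists y2 : 'cV[R]_p, forall i, (map_mx ratr G *m col_mx y1 y2) i 0 <= c i
      0).
    split=> -[y Hy]; exists y => i; have := Hy i;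
    rewrite split_col col_mxKu col_mxKd.
      by rewrite [X in _ <= X]mxE [X in _ + X]mxE -shift [X in _ -> X <= _]mxE.
    by rewrite [X in X <= _]mxE shift [X in _ -> _ <= X]mxE
      [X in _ -> _ <= _ + X]mxE.
  move=> ->; have E i : (map_mx ratr U *m (c - map_mx ratr (lsubmx G) *m y1)) i
    0 =
      (map_mx ratr U *m c) i 0 - ratr ((U *m lsubmx G) i 0) * y1 0 0.
    rewrite mulmxBr mulmxA -map_mxM [LHS]mxE; congr (_ + _).
    by rewrite [LHS]mxE; congr (- _); rewrite [LHS]mxE big_ord1 [in LHS]mxE.
  by split=> H i; have := H i; rewrite E subr_ge0.
split=> [[y Hy]|[t Ht]].
  exists (usubmx y 0 0); apply/step; exists (dsubmx y); by rewrite vsubmxK.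
have [|y2 Hy2] := (step (const_mx t)).2; first by rewrite mxE.
by exists (col_mx (const_mx t) y2).
Qed.

End Elimination.

(** * A union of rational MILP-R sets that is not rational MILP-R *)

(** Every tail of a sequence of naturals attains its minimum; jumping
    repeatedly from an index to a minimum of the tail after it gives the
    subsequence. *)
Lemma nondecreasing_subsequence (g : nat -> nat) :
  exists psi : nat -> nat, {homo psi : i j / (i < j)%N} /\
    {homo (g \o psi) : i j / (i <= j)%N}.
Proof.
have tail_min m : exists j, (m <= j)%N /\ forall i, (m <= i)%N ->
  (g j <= g i)%N.
  have ex : exists v, `[< exists2 j, (m <= j)%N & g j = v >].
    by exists (g m); apply/asboolP; exists m.
  case: (ex_minnP ex) => v /asboolP[j mj <-] vmin; exists j; split=> // i mi.
  by apply: vmin; apply/asboolP; exists i.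
have [mu Hmu] := choice tail_min.
pose psi := fix psi i := if i is i'.+1 then mu (psi i').+1 else mu 0%N.
have psiE i : psi i.+1 = mu (psi i).+1 by [].
have lt i : (psi i < psi i.+1)%N by rewrite psiE; exact: (Hmu _).1.
exists psi; split; first exact: homo_ltn ltn_trans lt.
apply: homo_leq => [//|? ? ?|i]; first exact: leq_trans.
have [m [Em mi]] : exists m, psi i = mu m /\ (m <= psi i)%N.
  by case: i => [|i]; [exists 0%N|exists (psi i).+1; rewrite psiE (Hmu _).1].
rewrite /comp Em; apply: (Hmu m).2.
by apply: leq_trans mi _; apply: ltnW.
Qed.

(** Refine the sequence one coordinate at a time: subsequences of a
    nondecreasing sequence stay nondecreasing. *)
Lemma Dickson n (f : nat -> 'I_n -> nat) :
  exists i j, (i < j)%N /\ forall a, (f i a <= f j a)%N.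
Proof.
suff [psi [incr mono]] : exists psi : nat -> nat, {homo psi : i j / (i < j)%N}
  /\
    forall a, a \in enum 'I_n -> {homo (fun i => f (psi i) a) : i j /
      (i <= j)%N}.
  exists (psi 0%N), (psi 1%N); split=> [|a]; first exact: incr.
  by apply: mono => //; rewrite mem_enum.
elim: (enum 'I_n) => [|a s [psi [incr mono]]]; first by exists id; split => //.
have [phi [incr' mono']] := nondecreasing_subsequence (fun i => f (psi i) a).
exists (psi \o phi); split=> [i j ij|b]; first exact/incr/incr'.
rewrite inE => /predU1P[->|bs] i j ij; first exact: mono'.
apply: mono => //; move: ij; rewrite leq_eqVlt => /predU1P[->//|/incr'].
exact: ltnW.
Qed.

Section NotMILP.
Variable R : realType.

Lemma half_not_int : (2^-1 : R) \isn't a Num.int.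
Proof.
apply/negP => /intrP[m Em].
have : (m * 2)%:~R = 1%:~R :> R by rewrite rmorphM /= -Em mulVf ?pnatr_eq0.
by move=> /intr_inj; lia.
Qed.

Definition half : set 'cV[R]_1 := [set x | x = const_mx 2^-1].

Lemma half_polyhedron : rational_polyhedron half.
Proof.
have -> : half = [set x | x = map_mx ratr (const_mx 2^-1)].
  by rewrite map_const_mx fmorphV rmorph_nat.
by apply: polyhedron_eq; [exact: ra_id|exact: ra_cst].
Qed.

(** The continuous variables are eliminated, so that only the integer variables
    are left besides x. *)
Lemma MILP_projection n (S : set 'cV[R]_n) : rational_MILP_R S ->
  exists d k (F : 'M[rat]_(k, n + d)) (c : 'cV[R]_k),
  forall x, S x <-> exists z : 'cV[R]_d, integer_points z /\
    forall i, (map_mx ratr F *m col_mx x z) i 0 <= c i 0.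
Proof.
move=> [p [d [M [[_ _ HM] [k [A [b ME]]]]]]].
pose Ax := lsubmx (lsubmx A); pose Ay := rsubmx (lsubmx A); pose Az := rsubmx A.
have [k' [U HU]] := eliminate R Ay.
exists d, k', (U *m row_mx Ax Az), (map_mx ratr U *m map_mx ratr b) => x.
have AE y (z : 'cV[R]_d) : map_mx ratr A *m col_mx (col_mx x y) z =
    map_mx ratr (row_mx Ax Az) *m col_mx x z + map_mx ratr Ay *m y.
  rewrite -[in LHS](hsubmxK A) -[in LHS](hsubmxK (lsubmx A)) !map_row_mx.
  by rewrite !mul_row_col addrAC.
have step z : (exists y, M (col_mx (col_mx x y) z)) <->
    forall i, (map_mx ratr (U *m row_mx Ax Az) *m col_mx x z) i 0 <=
              (map_mx ratr U *m map_mx ratr b) i 0.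
  have := HU (map_mx ratr b - map_mx ratr (row_mx Ax Az) *m col_mx x z).
  have -> : (forall s, 0 <= (map_mx ratr U *m
      (map_mx ratr b - map_mx ratr (row_mx Ax Az) *m col_mx x z)) s 0) <->
    forall i, (map_mx ratr (U *m row_mx Ax Az) *m col_mx x z) i 0 <=
              (map_mx ratr U *m map_mx ratr b) i 0.
    rewrite mulmxBr mulmxA map_mxM.
    by split=> H i; have := H i;
      rewrite [X in 0 <= X]mxE [X in _ + X]mxE subr_ge0.
  move=> <-; rewrite ME /=.
  have E y i : ((map_mx ratr A *m col_mx (col_mx x y) z) i 0 <= ratr (b i 0)) =
    ((map_mx ratr Ay *m y) i 0 <=
       (map_mx ratr b - map_mx ratr (row_mx Ax Az) *m col_mx x z) i 0).
    rewrite AE [X in X <= _]mxE [X in _ = (_ <= X)]mxE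
      [X in _ = (_ <= _ + X)]mxE.
    by rewrite lerBrDl [X in _ = (_ <= X)]mxE.
  by split=> -[y Hy]; exists y => i; have := Hy i; rewrite E.
rewrite HM; split=> [[y [z [Zz Myz]]]|[z [Zz /step[y Myz]]]].
  by exists z; split=> //; apply/step; exists y.
by exists y, z.
Qed.

(** With N a common denominator of F, the integers N F (j, z_j) are bounded
    above for every integer j; Dickson's lemma applies to their distances to
    the bound. *)
Lemma lattice_half_not_MILP : ~ rational_MILP_R (@integer_points R 1 `|` half).
Proof.
move=> /MILP_projection[d [k [F [c HS]]]].
have [N [N0 ZF]] := common_denominator F.
have NR0 : (0 : R) < N%:R by rewrite ltr0n.
have /choice[z Hz] : forall j : nat, exists z : 'cV[R]_d, integer_points z /\
    forall i, (map_mx ratr F *m col_mx (const_mx j%:R) z) i 0 <= c i 0.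
  move=> j; apply/HS; left; apply/mxOverP => a b; by rewrite mxE rpred_nat.
pose u j : 'cV[R]_(1 + d) := col_mx (const_mx j%:R) (z j).
have Zu j : u j \is a mxOver Num.int.
  apply/mxOverP => a b; case: (split_ordP a) => e ->.
    by rewrite col_mxEu mxE rpred_nat.
  by rewrite col_mxEd; apply: (mxOverP (Hz j).1).
pose h j i := N%:R * (map_mx ratr F *m u j) i 0.
have Zh j i : h j i \is a Num.int.
  rewrite /h mxE mulr_sumr; apply: rpred_sum => a _.
  rewrite mulrA rpredM //; last exact: (mxOverP (Zu j)).
  have /mxOverP/(_ i a) := ZF; rewrite !mxE => /(ratr_int_num R).
  by rewrite rmorphM /= ratr_nat.
pose e i := Num.floor (N%:R * c i 0).
have he j i : Num.floor (h j i) <= e i.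
  by apply: le_floor; rewrite ler_pM2l //; exact: (Hz j).2.
have [j1 [j2 [j12 Hj]]] := Dickson (fun j i => `|e i - Num.floor (h j i)|%N).
have Fle i : (map_mx ratr F *m u j2) i 0 <= (map_mx ratr F *m u j1) i 0.
  rewrite -(ler_pM2l NR0) -/(h j1 i) -/(h j2 i).
  rewrite -(eqP (etrans (esym (intrEfloor _)) (Zh j1 i))).
  rewrite -(eqP (etrans (esym (intrEfloor _)) (Zh j2 i))) ler_int.
  have := Hj i; have := he j1 i; have := he j2 i; lia.
have [zh [Zzh Hzh]] : exists zh : 'cV[R]_d, integer_points zh /\
    forall i, (map_mx ratr F *m col_mx (const_mx 2^-1) zh) i 0 <= c i 0.
  by apply/HS; right.
pose x : 'cV[R]_1 := const_mx (2^-1 + (j2%:R - j1%:R)).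
have : (@integer_points R 1 `|` half) x.
  apply/HS; exists (zh + (z j2 - z j1)); split.
    apply/mxOverP => a b; rewrite !mxE.
    apply: rpredD; first exact: (mxOverP Zzh).
    by apply: rpredB; apply: (mxOverP (Hz _).1).
  move=> i; have -> : col_mx x (zh + (z j2 - z j1)) =
      col_mx (const_mx 2^-1) zh + (u j2 - u j1).
    rewrite /u opp_col_mx !add_col_mx; congr col_mx.
    by apply/matrixP => a b; rewrite !mxE.
  rewrite mulmxDr mulmxBr [X in X <= _]mxE [X in _ + X]mxE
    [X in _ + (_ + X)]mxE.
  by have := Fle i; have := Hzh i; lra.
case=> [/mxOverP/(_ 0 0)|/matrixP/(_ 0 0)]; rewrite !mxE.
  move=> Zx; have /negP := half_not_int; apply.
  have -> : (2^-1 : R) = (2^-1 + (j2%:R - j1%:R)) - (j2%:R - j1%:R) by ring.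
  by rewrite !(rpredB, rpred_nat).
move=> E; have : (j2%:R : R) = j1%:R by lra.
by move=> /eqP; rewrite eqr_nat => /eqP E'; rewrite E' ltnn in j12.
Qed.

Lemma MILP_not_closed_unions : ~ closed_under_unions (@rational_MILP_R R).
Proof.
move=> H; apply: lattice_half_not_MILP.
have := H 1%N 2%N (fun i => if i == 0 then @integer_points R 1 else half) isT
  isT.
case=> [i|p [d [M HM]]].
  by case: ifP => _;
    [exact: lattice_MILP|exact: polyhedron_MILP half_polyhedron].
exists p, d, M; move: HM; congr (MICP_formulation M _ /\ _).
apply/seteqP; split=> [x [i _]|x [Zx|hx]].
- by case: ifP => _; [left|right].
- by exists 0.
by exists 1.
Qed.

End NotMILP.

(** * Integer fibres of rationally unbounded formulations *)

Section NotClosedIntersections.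
Variable R : realType.

Lemma finite_bounded_integer_points d (K : set 'cV[R]_d) :
  bounded_set K -> finite_set (K `&` @integer_points R d).
Proof.
move=> /bounded_cVP[B HB]; pose N := Num.truncn `|B|.
pose dec (w : 'cV['I_(N.*2.+1)]_d) : 'cV[R]_d :=
  \col_i ((w i 0 : nat)%:R - N%:R).
apply: (@sub_finite_set _ _ (dec @` setT));
  last exact/finite_image/finite_finset.
move=> z [Kz /mxOverP Zz].
pose f i := Num.floor (z i 0).
have zE i : z i 0 = (f i)%:~R by apply/eqP; rewrite eq_sym -intrEfloor;
  exact: Zz.
have bound i : (`|f i| <= N)%N.
  rewrite /N truncn_ge_nat ?normr_ge0 // natr_absz intr_norm -zE.
  exact: le_trans (HB z Kz i) (ler_norm _).
exists (\col_i inord (absz (f i + N%:Z))) => //.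
apply/colP => i; rewrite !mxE inordK; last by have := bound i; lia.
have -> : (absz (f i + N%:Z))%:R = (f i + N%:Z)%:~R :> R.
  by rewrite natr_absz ger0_norm //; have := bound i; lia.
by rewrite intrD addrK zE.
Qed.

(** The Smith normal form of the one-column matrix r: up to the unimodular
    change of coordinates L, an integer vector points along the first axis. *)
Lemma integer_direction d (r : 'cV[R]_(1 + d)) : integer_points r -> r != 0 ->
  exists (L U : 'M[int]_(1 + d)) (g : int),
    [/\ L *m U = 1%:M, U *m L = 1%:M, g != 0 &
        r = map_mx intr L *m col_mx (const_mx g%:~R) 0].
Proof.
move=> /mxOverP Zr nz; pose ri : 'cV[int]_(1 + d) := \col_i Num.floor (r i 0).
have rE : r = map_mx intr ri.
  apply/colP => i; rewrite !mxE; apply/eqP; rewrite eq_sym -intrEfloor;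
    exact: Zr.
have [L Lu [Q Qu [ds _ Eri]]] := int_Smith_normal_form ri.
pose g := ds`_0 * Q 0 0.
have rcol : r = map_mx intr L *m col_mx (const_mx g%:~R) 0.
  have -> : col_mx (const_mx g%:~R) 0 = map_mx intr (col_mx (const_mx g) 0)
      :> 'cV[R]_(1 + d) by rewrite map_col_mx map_const_mx map_mx0.
  rewrite rE Eri -map_mxM -mulmxA; congr (map_mx _ (_ *m _)).
  apply/colP => i; rewrite mxE big_ord1 mxE.
  case: (split_ordP i) => j ->; last by rewrite col_mxEd !mxE mul0r.
  by rewrite col_mxEu !mxE (ord1 j).
exists L, (invmx L), g; split=> //; [exact: mulmxV|exact: mulVmx|].
apply: contra nz => /eqP g0; rewrite rcol g0.
by rewrite (_ : const_mx _ = 0) ?col_mx0 ?mulmx0 //; apply/matrixP => i j;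
  rewrite !mxE.
Qed.

Lemma integer_points_mul m n (L : 'M[int]_(m, n)) (z : 'cV[R]_n) :
  integer_points z -> integer_points (map_mx intr L *m z).
Proof.
move=> Zz; rewrite /integer_points /=; apply: mxOverM => //.
by apply/mxOverP => i j; rewrite mxE intr_int.
Qed.

Definition convex_relation n d (G : 'cV[R]_n -> 'cV[R]_d -> Prop) : Prop :=
  forall (t : R) x y z w, 0 <= t <= 1 -> G x z -> G y w ->
    G (t *: x + (1 - t) *: y) (t *: z + (1 - t) *: w).

Section Fibres.
Variables (n : nat) (T : set 'cV[R]_n).
Hypothesis T_no_segment : forall x y, T x -> T y -> x <> y ->
  exists2 t : R, 0 <= t <= 1 & ~ T (t *: x + (1 - t) *: y).
Hypothesis T_no_progression : forall x u,
  (forall k : nat, T (x + k%:R *: u)) -> u = 0.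

Lemma integer_fibre_unique d (G : 'cV[R]_n -> 'cV[R]_d -> Prop) :
  convex_relation G -> (forall x z, integer_points z -> G x z -> T x) ->
  forall x y z, integer_points z -> G x z -> G y z -> x = y.
Proof.
move=> cG GT x y z Zz Gx Gy; apply: contrapT => xy.
have [t t01] := T_no_segment (GT _ _ Zz Gx) (GT _ _ Zz Gy) xy; apply.
apply: (GT _ z) => //; have := cG t x y z z t01 Gx Gy.
by rewrite -scalerDl [t + _]addrC subrK scale1r.
Qed.

(** Let X_k be the point over p + k e. Midpoints make X an arithmetic
    progression, so X is constant. As p lies on the segment from p - s e to p +
    e, the point X_0 is a convex combination of x and X_1 in which x has the
    positive weight 1 / (1 + s); hence x = X_0. *)
Lemma ray_fibre d (G : 'cV[R]_n -> 'cV[R]_d -> Prop) :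
  convex_relation G -> (forall x z, integer_points z -> G x z -> T x) ->
  forall (x : 'cV[R]_n) (p e : 'cV[R]_d) (s : R),
    integer_points p -> integer_points e -> 0 <= s ->
    G x (p - s *: e) -> (forall k : nat, exists x, G x (p + k%:R *: e)) -> T x.
Proof.
move=> cG GT x p e s Zp Ze s0 Gx /choice[X GX].
have uniq := integer_fibre_unique cG GT.
have Zpk k : integer_points (p + k%:R *: e).
  apply/mxOverP => i j; rewrite !mxE rpredD ?rpredM ?rpred_nat //.
    exact: (mxOverP Zp).
  exact: (mxOverP Ze).
have h01 : 0 <= (2^-1 : R) <= 1 by lra.
have S1 k : k.+1%:R = k%:R + 1 :> R by rewrite natr1.
have S2 k : k.+2%:R = k%:R + 2 :> R by rewrite -addn2 natrD.
have mid k : 2^-1 *: X k + (1 - 2^-1) *: X k.+2 = X k.+1.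
  apply: (uniq _ _ _ (Zpk k.+1)) => //.
  have := cG _ _ _ _ _ h01 (GX k) (GX k.+2); congr (G _ _).
  by apply/colP => i; rewrite !mxE S1 S2; field.
have XE k : X k = X 0%N + k%:R *: (X 1%N - X 0%N).
  suff [] : X k = X 0%N + k%:R *: (X 1%N - X 0%N) /\
            X k.+1 = X 0%N + k.+1%:R *: (X 1%N - X 0%N) by [].
  elim: k => [|k [IH1 IH2]].
    by rewrite scale0r addr0 scale1r addrC subrK.
  split=> //; have := mid k; rewrite IH2 IH1 => /colP H; apply/colP => i.
  have := H i; rewrite !mxE S1 S2; lra.
have X01 : X 1%N = X 0%N.
  apply/eqP; rewrite -subr_eq0; apply/eqP;
    apply: (@T_no_progression (X 0%N)) => k.
  by rewrite -XE; apply: GT (Zpk k) (GX k).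
have s1 : 0 < 1 + s by lra.
have t01 : 0 <= (1 + s)^-1 <= 1.
  by rewrite invr_ge0 ltW //= invf_le1 // lerDl.
have : (1 + s)^-1 *: x + (1 - (1 + s)^-1) *: X 1%N = X 0%N.
  apply: (uniq _ _ _ (Zpk 0%N)) (GX 0%N).
  have := cG _ _ _ _ _ t01 Gx (GX 1%N); congr (G _ _).
  by apply/colP => i; rewrite !mxE; field; rewrite gt_eqF.
rewrite X01 => /colP H; suff -> : x = X 0%N by apply: GT (Zpk 0%N) (GX 0%N).
apply/colP => i; have := H i; rewrite !mxE => E.
have : (1 + s)^-1 * (x i 0 - X 0%N i 0) = 0 by rewrite mulrBr; lra.
by move=> /eqP; rewrite mulf_eq0 invr_eq0 gt_eqF //= subr_eq0 => /eqP.
Qed.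

Lemma finite_of_bounded d (G : 'cV[R]_n -> 'cV[R]_d -> Prop) :
  convex_relation G -> (forall x z, integer_points z -> G x z -> T x) ->
  bounded_set [set z | exists x, G x z] ->
  finite_set [set x | exists2 z, integer_points z & G x z].
Proof.
move=> cG GT /finite_bounded_integer_points fZ.
apply: (sub_finite_set _ (finite_image (fun z => xget 0 [set x | G x z]) fZ)).
move=> x [z Zz Gx]; exists z; first by split=> //; exists x.
case: xgetP => [y _ Gy|/(_ x)//]; exact: (integer_fibre_unique cG GT Zz Gy Gx).
Qed.

(** Induction on d, stated for a convex relation instead of an inducing set
    since closedness is lost under the projections of the induction. In
    coordinates where the integer recession direction is an axis, forget that
    coordinate: integer points are still images of integer points, and by
    [ray_fibre] a real value of the forgotten coordinate gives no point outside
    T. *)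
Lemma finite_of_rationally_unbounded d (G : 'cV[R]_n -> 'cV[R]_d -> Prop) :
  convex_relation G -> (forall x z, integer_points z -> G x z -> T x) ->
  rationally_unbounded [set z | exists x, G x z] ->
  finite_set [set x | exists2 z, integer_points z & G x z].
Proof.
elim: d G => [|d IH] G cG GT uG.
  by apply: finite_of_bounded => //; apply/bounded_cVP; exists 0 => ? _ [].
rewrite -[d.+1]/(1 + d)%N in G cG GT uG *.
pose I := [set z | exists x, G x z].
have := uG _ 1%:M 0; rewrite /= -/I.
have -> : [set rational_affine 1%:M 0 z | z in I] = I.
  by apply/seteqP; split=> [_ [z Iz <-]|z Iz]; [|exists z => //];
    rewrite /rational_affine map_mx1 mul1mx map_mx0 addr0.
move=> [bI|[r [Zr [rec nz]]]]; first exact: finite_of_bounded.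
have {}nz : r != 0 by apply/eqP.
have [L [U [g [LU UL g0 rE]]]] := integer_direction Zr nz.
pose Lr : 'M[R]_(1 + d) := map_mx intr L;
  pose Ur : 'M[R]_(1 + d) := map_mx intr U.
have LUr : Lr *m Ur = 1%:M by rewrite -map_mxM LU map_mx1.
have ULr : Ur *m Lr = 1%:M by rewrite -map_mxM UL map_mx1.
(* The point with coordinates t and z in the basis of the columns of L. *)
pose flat (t : R) (z : 'cV[R]_d) : 'cV[R]_(1 + d) := Lr *m col_mx (const_mx t)
  z.
pose sg : R := Num.sg g%:~R; pose e := flat sg 0.
have gR0 : 0 < `|g%:~R : R| by rewrite normr_gt0 intr_eq0.
have flatD t s z : flat (t + sg * s) z = flat t z + s *: e.
  rewrite /flat scalemxAr -mulmxDr scale_col_mx add_col_mx scaler0 addr0.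
  by congr (_ *m col_mx _ _); apply/matrixP => i j; rewrite !mxE [sg * s]mulrC.
have eE : e = `|g%:~R|^-1 *: r.
  rewrite rE scalemxAr scale_col_mx scaler0; congr (_ *m col_mx _ _).
  apply/matrixP => i j; rewrite !mxE.
  by rewrite [X in _ * X]numEsg mulrCA mulVf ?mulr1 // gt_eqF.
have Zflat t z : t \is a Num.int -> integer_points z -> integer_points
  (flat t z).
  move=> Zt Zz; apply: integer_points_mul; apply/mxOverP => i j.
  case: (split_ordP i) => a ->; first by rewrite col_mxEu mxE.
  by rewrite col_mxEd; apply: (mxOverP Zz).
(* Moving along e reaches an integer first coordinate; whether this rounds up
   or down depends on the sign of g. *)
have round t : exists2 s, 0 <= s & t + sg * s \is a Num.int.
  have [gp|gn] := ltP (0 : R) g%:~R.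
    exists ((Num.ceil t)%:~R - t); first by rewrite subr_ge0 ceil_ge.
    by rewrite /sg gtr0_sg // mul1r addrC subrK intr_int.
  exists (t - (Num.floor t)%:~R); first by rewrite subr_ge0 floor_le_tmp.
  rewrite /sg ltr0_sg ?lt_neqAle ?intr_eq0 ?g0 // mulN1r opprB addrC subrK.
  exact: intr_int.
pose G2 x z := exists t, G x (flat t z).
apply: (sub_finite_set _ (IH G2 _ _ _)).
- move=> x [z Zz Gx]; exists (dsubmx (Ur *m z)).
    apply/mxOverP => i j; rewrite mxE;
      apply: (mxOverP (integer_points_mul _ Zz)).
  exists ((usubmx (Ur *m z)) 0 0); rewrite /flat.
  have -> : const_mx (usubmx (Ur *m z) 0 0) = usubmx (Ur *m z).
    by apply/matrixP => i j; rewrite (ord1 i) (ord1 j) mxE.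
  by rewrite vsubmxK mulmxA LUr mul1mx.
- move=> a x y z w a01 [t Gx] [s Gy]; exists (a * t + (1 - a) * s).
  have := cG _ _ _ _ _ a01 Gx Gy; congr (G _ _).
  rewrite /flat !scalemxAr -mulmxDr !scale_col_mx add_col_mx.
  by congr (_ *m col_mx _ _); apply/matrixP => i j; rewrite !mxE.
- move=> x z Zz [t Gx]; have [s s0 Zts] := round t.
  apply: (@ray_fibre _ G cG GT x (flat (t + sg * s) z) e s) => //.
  + exact: Zflat.
  + apply: Zflat; last by apply/mxOverP => i j; rewrite mxE rpred0.
    by rewrite /sg -intr_sg intr_int.
  + by rewrite flatD addrK.
  move=> k; rewrite flatD -addrA -scalerDl eE scalerA.
  apply: rec; first by exists x.
  by rewrite mulr_ge0 ?addr_ge0 ?ler0n // invr_ge0 ltW.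
have raU : is_rational_affine (fun z : 'cV[R]_(1 + d) => dsubmx (Ur *m z)).
  apply: ra_dsub; exists (map_mx intr U), 0 => z.
  rewrite /rational_affine map_mx0 addr0; congr (_ *m _).
  by apply/matrixP => i j; rewrite !mxE ratr_int.
have := ru_image raU uG; congr rationally_unbounded; apply/seteqP; split.
  move=> _ [z [x Gx] <-]; exists x, (usubmx (Ur *m z) 0 0); rewrite /flat.
  have -> : const_mx (usubmx (Ur *m z) 0 0) = usubmx (Ur *m z).
    by apply/matrixP => i j; rewrite (ord1 i) (ord1 j) mxE.
  by rewrite vsubmxK mulmxA LUr mul1mx.
move=> z [x [t Gx]]; exists (flat t z); first by exists x.
by rewrite /flat mulmxA ULr mul1mx col_mxKd.
Qed.

(** For a fixed z, the points x with (x, y, z) in M for some y form the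
    relation of the previous lemma. *)
Lemma infinite_not_rational_MICP : infinite_set T -> ~ rational_MICP_R T.
Proof.
move=> infT [p [d [M [[_ cM HM] uM]]]]; apply: infT.
pose G (x : 'cV[R]_n) (z : 'cV[R]_d) := exists y : 'cV[R]_p, M
  (col_mx (col_mx x y) z).
apply: (sub_finite_set _ (@finite_of_rationally_unbounded d G _ _ _)).
- by move=> x /HM[y [z [Zz Mz]]]; exists z => //; exists y.
- move=> t x y z w t01 [a Ma] [b Mb]; exists (t *: a + (1 - t) *: b).
  have := (convex_setP _).1 cM t _ _ t01 Ma Mb; congr M.
  by rewrite !scale_col_mx !add_col_mx.
- by move=> x z Zz [y My]; apply/HM; exists y, z.
move: uM; congr rationally_unbounded; apply/seteqP; split.
  move=> _ [v Mv <-]; exists (usubmx (usubmx v)), (dsubmx (usubmx v)).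
  by rewrite !vsubmxK.
by move=> z [x [y Mz]]; exists (col_mx (col_mx x y) z); rewrite ?col_mxKd.
Qed.

End Fibres.
End NotClosedIntersections.

(** * An intersection of rational MICP-R sets that is not rational MICP-R *)

Section IrrationalStrip.
Variable R : realType.

Let sqrt2 : R := Num.sqrt 2.

(** In 2 m^2 = l^2 the exponent of 2 is odd on the left and even on the right.
    *)
Lemma sqrt2_irrational (a b : R) :
  a \is a Num.int -> b \is a Num.int -> sqrt2 * a = b -> a = 0.
Proof.
move=> /intrP[m ->] /intrP[l ->] E.
have E2 : 2 * m ^+ 2 = l ^+ 2 :> int.
  apply/eqP; rewrite -(eqr_int R) rmorphM /= !rmorphXn /= -E exprMn sqr_sqrtr
    //.
have {}E2 : (2 * (absz m * absz m) = absz l * absz l)%N.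
  by rewrite -!abszM -!expr2 -E2 abszM.
have [->//|m0] := eqVneq m 0; exfalso.
have m0' : (0 < absz m)%N by rewrite absz_gt0.
have l0' : (0 < absz l)%N.
  by rewrite lt0n; apply/eqP => l0; move: E2; rewrite l0; nia.
have := congr1 (logn 2) E2; rewrite !lognM ?muln_gt0 ?m0' //.
rewrite (_ : logn 2 2 = 1)%N //; lia.
Qed.

Definition strip_value (x : 'cV[R]_2) : R := sqrt2 * x 0 0 - x 1 0.

Definition strip : set 'cV[R]_2 := [set x | `|strip_value x| <= 1].

Lemma strip_closed : closed strip.
Proof.
have cont (T : topologicalType) (f g : T -> R) : continuous f -> continuous g ->
    continuous (fun x => sqrt2 * f x - g x).
  move=> cf cg x; apply: cvgB; last exact: cg.
  by apply: cvgM; [exact: cvg_cst|exact: cf].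
have -> : strip = strip_value @^-1` ([set r | r <= 1] `&` [set r | -1 <= r]).
  by apply/seteqP; split=> x; rewrite /strip /= ler_norml;
    [case/andP|case=> -> ->].
apply: preimage_closed;
  last exact: closedI (@closed_le _ 1) (@closed_ge _ (-1)).
by move=> x _; apply: (cont 'cV[R]_2); exact: coord_continuous.
Qed.

Lemma strip_convex : convex_set strip.
Proof.
apply/convex_setP => t v w /andP[t0 t1]; rewrite /strip /= !ler_norml.
move=> /andP[v1 v2] /andP[w1 w2].
have -> : strip_value (t *: v + (1 - t) *: w) =
    t * strip_value v + (1 - t) * strip_value w.
  by rewrite /strip_value !mxE; ring.
by apply/andP; split; nra.
Qed.

Definition strip_lattice : set 'cV[R]_2 := @integer_points R 2 `&` strip.

(** For every natural k, the point (k, floor(sqrt 2 k)) belongs to the strip.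
    *)
Lemma strip_lattice_infinite : infinite_set strip_lattice.
Proof.
move=> /(finite_image (fun x : 'cV[R]_2 => Num.truncn (x 0 0))).
move=> fin; apply: infinite_nat; apply: sub_finite_set fin => k _.
pose x : 'cV[R]_2 := \col_i (if i == 0 then k%:R else
  (Num.floor (sqrt2 * k%:R))%:~R).
exists x; last by rewrite mxE natrK.
split; first by apply/mxOverP => i j; rewrite mxE; case: ifP;
  rewrite ?rpred_nat ?intr_int.
rewrite /strip /strip_value /= !mxE /=.
have /andP[h1 h2] := floor_itv (sqrt2 * k%:R).
by rewrite ger0_norm; lra.
Qed.

(** Two distinct lattice points differ by a nonzero integer D in some
    coordinate; the weight 1 / (2 |D|) moves that coordinate by exactly one
    half. *)
Lemma strip_lattice_no_segment x y : strip_lattice x -> strip_lattice y -> x <>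
  y ->
  exists2 t : R, 0 <= t <= 1 & ~ strip_lattice (t *: x + (1 - t) *: y).
Proof.
move=> [/mxOverP Zx _] [/mxOverP Zy _] xy.
have [i xyi] : exists i, x i 0 != y i 0.
  apply: contrapT => /forallNP H; apply: xy; apply/colP => i.
  by apply/eqP/negP => /negP/H.
have D1 : 1 <= `|x i 0 - y i 0|.
  by apply: norm_intr_ge1; rewrite ?subr_eq0 // rpredB.
set D := x i 0 - y i 0 in D1.
have D0 : D != 0 by rewrite subr_eq0.
exists (2 * `|D|)^-1.
  by apply/andP; split; [rewrite invr_ge0; lra|rewrite invf_le1; lra].
move=> [/mxOverP/(_ i 0)]; rewrite !mxE => Zt _.
have : (2 * `|D|)^-1 * D \is a Num.int.
  have -> : (2 * `|D|)^-1 * D = (2 * `|D|)^-1 * x i 0 + (1 - (2 * `|D|)^-1) * y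
    i 0
     - y i 0 by rewrite /D; ring.
  by rewrite rpredB.
have -> : (2 * `|D|)^-1 * D = 2^-1 * Num.sg D.
  by rewrite {2}[D]numEsg; field; rewrite normr_eq0.
move=> Zh; have := half_not_int R; case: (ltrgtP D 0) Zh => [Dn|Dp|DE].
- by rewrite ltr0_sg // mulrN1 rpredN => ->.
- by rewrite gtr0_sg // mulr1 => ->.
by rewrite DE eqxx in D0.
Qed.

(** The values of sqrt 2 x_0 - x_1 are bounded along a progression in the
    strip, so sqrt 2 u_0 = u_1; and u, a difference of lattice points, is an
    integer vector. *)
Lemma strip_lattice_no_progression x u :
  (forall k : nat, strip_lattice (x + k%:R *: u)) -> u = 0.
Proof.
move=> H.
have Zu i : u i 0 \is a Num.int.
  have [/mxOverP/(_ i 0) Z0 _] := H 0%N; have [/mxOverP/(_ i 0) Z1 _] := H 1%N.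
  move: Z0 Z1; rewrite !mxE mul0r addr0 mul1r => Z0 Z1.
  have -> : u i 0 = x i 0 + u i 0 - x i 0 by ring.
  exact: rpredB.
have vE k : strip_value (x + k%:R *: u) = strip_value x + k%:R * strip_value u.
  by rewrite /strip_value !mxE; ring.
have bound k : k%:R * `|strip_value u| <= 2.
  have [_ h0] := H 0%N; have [_ hk] := H k; move: h0 hk.
  rewrite /strip /= !vE mul0r addr0 => h0 hk.
  rewrite -[k%:R]normr_nat -normrM.
  have -> : k%:R * strip_value u =
    strip_value x + k%:R * strip_value u - strip_value x by ring.
  have := ler_normB (strip_value x + k%:R * strip_value u) (strip_value x); lra.
have v0 : strip_value u = 0.
  apply/eqP; rewrite -normr_le0 leNgt; apply/negP => v0.
  have := bound (Num.truncn (2 / `|strip_value u|)).+1.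
  rewrite leNgt => /negP; apply; rewrite -ltr_pdivrMr //; exact: truncnS_gt.
have E : sqrt2 * u 0 0 = u 1 0 by apply/eqP; rewrite -subr_eq0; apply/eqP.
have u0 := sqrt2_irrational (Zu 0) (Zu 1) E.
have u1 : u 1 0 = 0 by rewrite -E u0 mulr0.
by apply/colP => -[[|[|//]] li]; rewrite mxE;
  [rewrite -[RHS]u0|rewrite -[RHS]u1];
  congr (u _ _); apply: val_inj.
Qed.

Lemma rational_MICP_not_closed_intersections :
  ~ closed_under_intersections (@rational_MICP_R R).
Proof.
move=> H; apply: (@infinite_not_rational_MICP R 2 strip_lattice).
- exact: strip_lattice_no_segment.
- exact: strip_lattice_no_progression.
- exact: strip_lattice_infinite.
have := H 2%N 2%N (fun i => if i == 0 then @integer_points R 2 else strip) isT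
  isT.
case=> [i|p [d [M [HM uM]]]].
  case: ifP => _; first exact: lattice_rational_MICP.
  exact: convex_rational_MICP strip_closed strip_convex.
exists p, d, M; split=> //; move: HM; congr (MICP_formulation M _).
apply/seteqP; split=> [x Hx|x [Zx Sx] i _]; last by case: ifP.
by split; [exact: (Hx 0 I)|exact: (Hx 1 I)].
Qed.

End IrrationalStrip.


Theorem proposition5p3 (R : realType) :
  [/\ [/\ closed_under_rational_affine (@rational_MILP_R R),
          closed_under_rational_affine (@binary_MICP_R R),
          closed_under_rational_affine (@MICP_R R) &
          closed_under_rational_affine (@rational_MICP_R R)],
      [/\ closed_under_products (@rational_MILP_R R),
          closed_under_products (@binary_MICP_R R),
          closed_under_products (@MICP_R R) &
          closed_under_products (@rational_MICP_R R)] &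
      [/\ closed_under_Minkowski_sums (@rational_MILP_R R),
          closed_under_Minkowski_sums (@binary_MICP_R R),
          closed_under_Minkowski_sums (@MICP_R R) &
          closed_under_Minkowski_sums (@rational_MICP_R R)]] /\
  [/\ closed_under_intersections (@rational_MILP_R R),
      closed_under_intersections (@binary_MICP_R R),
      closed_under_intersections (@MICP_R R) &
      ~ closed_under_intersections (@rational_MICP_R R)] /\
  [/\ closed_under_unions (@binary_MICP_R R),
      closed_under_unions (@MICP_R R),
      closed_under_unions (@rational_MICP_R R) &
      ~ closed_under_unions (@rational_MILP_R R)].
Proof.
split; [split; split|split; split].
- exact: affine_of_coupling (@MILP_polyhedral_coupling R).
- exact: affine_of_coupling (@binary_polyhedral_coupling R).
- exact: affine_of_coupling (@MICP_polyhedral_coupling R).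
- exact: rational_MICP_affine.
- exact: MILP_products.
- exact: binary_products.
- exact: MICP_products.
- exact: rational_MICP_products.
- apply: Minkowski_of_products; first exact: MILP_products.
  exact: affine_of_coupling (@MILP_polyhedral_coupling R).
- apply: Minkowski_of_products; first exact: binary_products.
  exact: affine_of_coupling (@binary_polyhedral_coupling R).
- apply: Minkowski_of_products; first exact: MICP_products.
  exact: affine_of_coupling (@MICP_polyhedral_coupling R).
- apply: Minkowski_of_products; first exact: rational_MICP_products.
  exact: rational_MICP_affine.
- exact: intersections_of_coupling (@MILP_products R) (@MILP_polyhedral_coupling R).
- exact: intersections_of_coupling (@binary_products R) (@binary_polyhedral_coupling R).
- exact: intersections_of_coupling (@MICP_products R) (@MICP_polyhedral_coupling R).
- exact: rational_MICP_not_closed_intersections.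
- exact: unions_of_switch (@binary_products R) (@binary_switch R).
- exact: unions_of_switch (@MICP_products R) (@MICP_switch R).
- exact: unions_of_switch (@rational_MICP_products R) (@rational_MICP_switch R).
- exact: MILP_not_closed_unions.
Qed.
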